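(* Let $\mathscr B$ be a doubling and regular ball-basis in a measure space $(X,\mathfrak M,\mu)$, let $1\le r<\infty$, and let $\omega(t)=1/\log_2(1+t)$ for $t\ge 1$. Let $\{T_\alpha\}$ be a uniformly vanishing family of linear operators $T_\alpha:L^r(X)\to L^0(X)$ with $T_\alpha\in\mathrm{BO}_\omega(X)$. Let $T$ be one of the operators $$T^+(f)=\sup_\alpha T_\alpha(f),\qquad T^-(f)=\inf_\alpha T_\alpha(f),\qquad T^*(f)=\sup_\alpha|T_\alpha(f)|,$$ and suppose that $\|T\|_{L^r(X)\to L^{r,\infty}(X)}<\infty$ and $\sup_\alpha\mathcal L_\omega(T_\alpha)<\infty$. Then for every $f\in\mathrm{BMO}(X)\cap L^r(X)$ we have $T(f)\in\mathrm{BMO}(X)$ and $$\|T(f)\|_{\mathrm{BMO}(X)}\le C\|f\|_{\mathrm{BMO}(X)},$$ where $C$ depends only on the ball-basis, $r$, $\|T\|_{L^r(X)\to L^{r,\infty}(X)}$ and $\sup_\alpha\mathcal L_\omega(T_\alpha)$.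
   Context: **Ball-basis.** Let $(X,\mathfrak M,\mu)$ be a measure space. A family $\mathscr B\subset\mathfrak M$ (its members are called balls) is a ball-basis if: (B1) $0<\mu(B)<\infty$ for every $B\in\mathscr B$; (B2) for any $x,y\in X$ there is a ball containing both $x$ and $y$; (B3) for every $E\in\mathfrak M$ and $\varepsilon>0$ there is a finite or infinite sequence of balls $B_k$ with $\mu(E\triangle\bigcup_kB_k)<\varepsilon$; (B4) for every $B\in\mathscr B$ there is a ball $B^*\in\mathscr B$ (the hull-ball of $B$, fixed once and for all) such that $\bigcup\{A\in\mathscr B:\mu(A)\le2\mu(B),\ A\cap B\ne\varnothing\}\subset B^*$ and $\mu(B^* )\le\mathcal K\mu(B)$, with a constant $\mathcal K>0$ independent of $B$. Doubling: there is $\eta>2$ such that for every ball $B$ with $B^*\ne X$ there is a ball $B'\supset B$ with $2\mu(B)\le\mu(B')\le\eta\mu(B)$. Regular: there is $0<\theta<1$ such that for any balls $A,B$ with $\mu(B)\le\mu(A)$ and $A\cap B\neq\varnothing$ we have $\mu(B^*\cap A)\ge\theta\mu(B^* )$. **Notation.** $L^0(X)$ is the space of a.e. finite measurable functions. $f_B=\frac1{\mu(B)}\int_Bf$, $\langle f\rangle_B=\big(\frac1{\mu(B)}\int_B|f|^r\big)^{1/r}$, $\langle f\rangle_{\#,B}=\langle f-f_B\rangle_B$. $\mathrm{BMO}(X)$ is the family of functions with $\|f\|_{\mathrm{BMO}}=\sup_{B\in\mathscr B}\langle f\rangle_{\#,B}<\infty$. $\mathrm{OSC}_E(F)=\operatorname{ess\,sup}_{x,x'\in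 E}|F(x)-F(x')|$. Outer measure: $\mu^*(E)=\inf_{F\in\mathfrak M,F\supset E}\mu(F)$. For an arbitrary function $F$, $\|F\|_{L^{r,\infty}}=\sup_{t>0}t\,(\mu^*\{|F|>t\})^{1/r}$; $\|T\|_{L^r\to L^{r,\infty}}$ is the supremum of $\|T(f)\|_{L^{r,\infty}}/\|f\|_{L^r}$ over nonzero $f\in L^r(X)$. The function $T(f)$ may be non-measurable; $L^r$-averages of a non-measurable function $F$ over $B$ are defined via $\int_B|F|^r=r\int_0^\infty t^{r-1}\mu^*\{x\in B:|F(x)|>t\}\,dt$, and for non-measurable $F$ the quantity $\langle F\rangle_{\#,B}$ is read as $\inf_{c\in\mathbb R}\langle F-c\rangle_B$. **Operators.** For non-increasing $\omega:[1,\infty)\to[0,1]$, an operator $T:L^r(X)\to L^0(X)$ belongs to $\mathrm{BO}_\omega(X)$ if it is sublinear, $|T(f+g)|\le|T(f)|+|T(g)|$, and there is a finite constant $L$ with $$\mathrm{OSC}_B\big(T(f\cdot\mathbf 1_{X\setminus B^*})\big)\le L\sup_{A\in\mathscr B:A\supset B}\Big(\omega\Big(\frac{\mu(A)}{\mu(B)}\Big)\langle f\rangle_A\Big)$$ for all $f\in L^r(X)$ and all balls $B$; $\mathcal L_\omega(T)$ denotes the least such $L$. A family of operators $T_\alpha:L^r(X)\to L^0(X)$ is uniformly vanishing if for every ball $B$ and $\varepsilon>0$ there is a ball $B'\supset B$, independent of $\alpha$, such that $\mathrm{OSC}_B(T_\alpha(\mathbf 1_{B''}))\le\varepsilon$ for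 every ball $B''\supset B'$ and every $\alpha$.
   Formalization: The formal theorem also assumes that the null sets off which each T_α f is finite, T_α is linear, and T_α f oscillates on a ball by at most its OSC can be chosen independently of α (automatic for countable families); without this the claim fails for some uncountable families. *)

(* Defs.v *)
From mathcomp Require Import all_boot all_order all_algebra.
From mathcomp Require Import all_classical all_reals all_analysis.
From mathcomp Require Import measurable_realfun.

Set Implicit Arguments.
Unset Strict Implicit.
Unset Printing Implicit Defensive.

Import Order.TTheory GRing.Theory Num.Theory.
Import numFieldNormedType.Exports.

Local Open Scope classical_set_scope.
Local Open Scope ring_scope.
Local Open Scope ereal_scope.

(* In (B3) a finite or infinite sequence of balls is a sequence indexed by an
   arbitrary set [D] of natural numbers; [D] may be empty. *)
Record ball_basis (R : realType) (d : measure_display) (X : measurableType d)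
    (mu : {measure set X -> \bar R}) := BallBasis {
  balls : set (set X) ;
  hull : set X -> set X ;
  hull_const : R ;
  balls_measurable : forall B, balls B -> measurable B ;
  balls_measure_gt0 : forall B, balls B -> 0 < mu B ;
  balls_measure_lty : forall B, balls B -> mu B < +oo ;
  balls_cover2 : forall x y : X, exists B, [/\ balls B, B x & B y] ;
  balls_approx : forall (E : set X) (e : R), measurable E -> (0 < e)%R ->
    exists (D : set nat) (F : nat -> set X),
      (forall k, D k -> balls (F k)) /\
      mu (E `+` \bigcup_(k in D) F k) < e%:E ;
  hull_const_gt0 : (0 < hull_const)%R ;
  hull_balls : forall B, balls B -> balls (hull B) ;
  hull_sub : forall B, balls B ->
    \bigcup_(A in [set A | [/\ balls A, mu A <= 2%:E * mu B &
                               A `&` B !=set0]]) A `<=` hull B ;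
  hull_measure : forall B, balls B -> mu (hull B) <= hull_const%:E * mu B
}.

Section defs.
Context {R : realType} {d : measure_display} {X : measurableType d}
        {mu : {measure set X -> \bar R}}.
Variable BB : ball_basis mu.
Implicit Types (A B E : set X) (F : X -> \bar R) (f g : X -> R) (r t : R).

Definition doubling : Prop := exists2 eta : R, (2 < eta)%R &
  forall B, balls BB B -> hull BB B <> setT ->
    exists B', [/\ balls BB B', B `<=` B', 2%:E * mu B <= mu B' &
                   mu B' <= eta%:E * mu B].

Definition regular : Prop := exists2 theta : R, (0 < theta < 1)%R &
  forall A B, balls BB A -> balls BB B -> mu B <= mu A -> A `&` B !=set0 ->
    theta%:E * mu (hull BB B) <= mu (hull BB B `&` A).

Definition outer E : \bar R :=
  ereal_inf [set mu F | F in [set F | measurable F /\ E `<=` F]].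

Definition mean F B : \bar R :=
  ((fine (mu B))^-1)%:E * \int[mu]_(x in B) F x.

Definition int_pow r F B : \bar R :=
  if `[< measurable_fun setT F >] then \int[mu]_(x in B) `|F x| `^ r
  else r%:E * \int[lebesgue_measure]_(t in `]0%R, +oo[)
                ((t `^ (r - 1))%:E * outer [set x | B x /\ t%:E < `|F x|]).

Definition avg r F B : \bar R :=
  (((fine (mu B))^-1)%:E * int_pow r F B) `^ r^-1.

Definition sharp_avg r F B : \bar R :=
  if `[< measurable_fun setT F >] then avg r (fun x => F x - mean F B) B
  else ereal_inf [set avg r (fun x => F x - c%:E) B | c in @setT R].

Definition bmo_norm r F : \bar R :=
  ereal_sup [set sharp_avg r F B | B in balls BB].

Definition BMO r F : Prop := bmo_norm r F < +oo.

(* The essential supremum of |F x - F x'| over x, x' in E. *)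
Definition osc E F : \bar R :=
  ereal_inf [set M | exists2 N : set X, mu.-negligible N &
    forall x x', (E `\` N) x -> (E `\` N) x' -> `|F x - F x'| <= M].

Definition weak_norm r F : \bar R :=
  ereal_sup [set t%:E * outer [set x | t%:E < `|F x|] `^ r^-1
            | t in [set t | (0 < t)%R]].

Definition L0 F : Prop :=
  measurable_fun setT F /\ \forall x \ae mu, F x \is a fin_num.

Definition omega_log t : R := ((ln (1 + t) / ln 2)^-1)%R.

(* Operators act on functions; only their values on [Lfun mu r%:E] matter. *)
Definition operator := (X -> R) -> X -> \bar R.
Implicit Types T : operator.

Definition opnorm r T : \bar R :=
  ereal_sup [set weak_norm r (T f) * ((fine ('N[mu]_r%:E[EFin \o f]))^-1)%:E
            | f in [set f | f \in Lfun mu r%:E /\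
                            'N[mu]_r%:E[EFin \o f] != 0]].

(* T : L^r(X) -> L^0(X), compatible with almost everywhere equality. *)
Definition Lr_L0 r T : Prop :=
  (forall f, f \in Lfun mu r%:E -> L0 (T f)) /\
  (forall f g, f \in Lfun mu r%:E -> g \in Lfun mu r%:E ->
    (\forall x \ae mu, f x = g x) -> \forall x \ae mu, T f x = T g x).

Definition linear_op r T : Prop :=
  forall (a : R) f g, f \in Lfun mu r%:E -> g \in Lfun mu r%:E ->
    \forall x \ae mu, T (fun y => a * f y + g y)%R x = a%:E * T f x + T g x.

Definition sublinear_op r T : Prop :=
  forall f g, f \in Lfun mu r%:E -> g \in Lfun mu r%:E ->
    \forall x \ae mu, `|T (f \+ g)%R x| <= `|T f x| + `|T g x|.

Definition BO_bound r (omega : R -> R) T (L : R) : Prop :=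
  forall f B, f \in Lfun mu r%:E -> balls BB B ->
    osc B (T (fun x => f x * \1_(~` hull BB B) x)%R) <=
    L%:E * ereal_sup
      [set (omega (fine (mu A) / fine (mu B)))%:E * avg r (EFin \o f) A
      | A in [set A | balls BB A /\ B `<=` A]].

Definition BO r (omega : R -> R) T : Prop :=
  [/\ Lr_L0 r T, sublinear_op r T & exists L : R, BO_bound r omega T L].

Definition BO_norm r (omega : R -> R) T : \bar R :=
  ereal_inf [set L%:E | L in BO_bound r omega T].

Section family.
Variables (I : Type) (T_ : I -> operator).

Definition uniformly_vanishing : Prop :=
  forall B (e : R), balls BB B -> (0 < e)%R ->
    exists B', [/\ balls BB B', B `<=` B' &
      forall B'' i, balls BB B'' -> B' `<=` B'' ->
        osc B (T_ i \1_B'') <= e%:E].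

(* The exceptional null sets in the almost everywhere statements "T_i f is
   finite", "T_i is linear" and "T_i f oscillates on B by at most osc B (T_i f)"
   can be chosen independently of i. This is automatic when the family is
   countable, see [countable_common_null_sets]; for an uncountable family it is
   what makes the pointwise supremum of the T_i f meaningful. *)
Definition common_null_sets r : Prop :=
  [/\ forall f, f \in Lfun mu r%:E ->
        \forall x \ae mu, forall i, T_ i f x \is a fin_num,
      forall (a : R) f g, f \in Lfun mu r%:E -> g \in Lfun mu r%:E ->
        \forall x \ae mu, forall i,
          T_ i (fun y => a * f y + g y)%R x = a%:E * T_ i f x + T_ i g x &
      forall f B, f \in Lfun mu r%:E -> balls BB B ->
        exists2 N : set X, mu.-negligible N &
          forall i x x', (B `\` N) x -> (B `\` N) x' ->
            `|T_ i f x - T_ i f x'| <= osc B (T_ i f)].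

Definition sup_op : operator := fun f x => ereal_sup [set T_ i f x | i in setT].
Definition inf_op : operator := fun f x => ereal_inf [set T_ i f x | i in setT].
Definition sup_abs_op : operator :=
  fun f x => ereal_sup [set `|T_ i f x| | i in setT].

End family.

Lemma osc_attained E F : exists2 N : set X, mu.-negligible N &
  forall x x', (E `\` N) x -> (E `\` N) x' -> `|F x - F x'| <= osc E F.
Proof.
rewrite /osc; set S := [set M | _].
have S0 : S != set0.
  by apply/set0P; exists +oo, set0 => [|x x' _ _]; [exact: negligible_set0|rewrite leey].
have [u uS uinf] := ereal_inf_seq S0.
have /choice[N HN] : forall n, exists N : set X, mu.-negligible N /\
    forall x x', (E `\` N) x -> (E `\` N) x' -> `|F x - F x'| <= u n.
  by move=> n; have [N N0 HN] := uS n; exists N.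
exists (\bigcup_n N n); first by apply: negligible_bigcup => n; case: (HN n).
move=> x x' [Ex Nx] [Ex' Nx']; rewrite -(cvg_lim _ uinf)//.
apply: lime_ge; first by apply/cvgP: uinf.
apply: nearW => n; case: (HN n) => _; apply; split=> //.
- by move=> Nnx; apply: Nx; exists n.
- by move=> Nnx; apply: Nx'; exists n.
Qed.

Lemma countable_common_null_sets r (I : countType) (T_ : I -> operator) :
  (forall i, Lr_L0 r (T_ i)) -> (forall i, linear_op r (T_ i)) ->
  common_null_sets T_ r.
Proof.
move=> TL0 Tlin.
have ae_forall (P : I -> X -> Prop) : (forall i, \forall x \ae mu, P i x) ->
    \forall x \ae mu, forall i, P i x.
  move=> HP.
  have : \forall x \ae mu, forall n : nat,
      if @unpickle I n is Some i then P i x else True.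
    apply/ae_foralln => n.
    by case: (@unpickle I n) => [i|]; [exact: HP|exact: nearW].
  by apply: filterS => x Hx i; have := Hx (pickle i); rewrite pickleK.
split.
- by move=> f fL; apply: ae_forall => i; case: (TL0 i) => /(_ f fL) [].
- by move=> a f g fL gL; apply: ae_forall => i; exact: Tlin.
- move=> f B fL _.
  have /choice[N HN] : forall i, exists N : set X, mu.-negligible N /\
      forall x x', (B `\` N) x -> (B `\` N) x' ->
        `|T_ i f x - T_ i f x'| <= osc B (T_ i f).
    by move=> i; have [N N0 HN] := osc_attained B (T_ i f); exists N.
  pose N' n := if @unpickle I n is Some i then N i else set0.
  exists (\bigcup_n N' n).
    apply: negligible_bigcup => n; rewrite /N'.
    by case: unpickle => [i|]; [case: (HN i)|exact: negligible_set0].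
  move=> i x x' [Bx Nx] [Bx' Nx']; case: (HN i) => _; apply; split=> // Nix.
  + by apply: Nx; exists (pickle i) => //; rewrite /N' pickleK.
  + by apply: Nx'; exists (pickle i) => //; rewrite /N' pickleK.
Qed.

End defs.

(* Main.v *)
Require Import Defs.
From mathcomp Require Import all_boot all_order all_algebra.
From mathcomp Require Import all_classical all_reals all_analysis.
From mathcomp Require Import measurable_realfun ring lra.
Set Implicit Arguments.
Unset Strict Implicit.
Unset Printing Implicit Defensive.
Import Order.TTheory GRing.Theory Num.Theory.
Import numFieldNormedType.Exports.
Local Open Scope classical_set_scope.
Local Open Scope ring_scope.
Local Open Scope ereal_scope.

(** Why [T] maps [BMO] into [BMO].

    Fix a ball [B], and let [c B] be the mean of [f] over [B]. Up to a multiple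
    [c B * \1_G] of the indicator of a huge ball [G], on which the family nearly
    vanishes, [f] is the sum of a near part, [f - c B] on the hull of [B], and a far
    part, [f - c B * \1_G] off the hull. The near part has [L^r] average
    [O(norm of f)], so the weak type bound controls its image off a small set; using it
    at [h] and at [- h] controls all members of the family simultaneously
    ([family_tail]). The images of the far part oscillate on [B] by at most the
    supremum over balls [A] containing [B] of [omega (mu A / mu B)] times the average
    of the far part over [A]. Doubling lets one climb from [B] to [A] in
    [log2 (mu A / mu B)] steps, and each step changes the mean of [f] by
    [O(norm of f)], so this average grows at most like [log2 (1 + mu A / mu B)]
    ([growth_log]); that is exactly the reciprocal of [omega] ([omega_growth]).
    Since suprema and infima of families are 1-Lipschitz in the values of the
    family, [T f] is, off a small part of [B], within [O(norm of f)] of a constant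
    ([local_estimate]).

    The weak type bound alone gives no [L^r] bound for the oscillation of [T f]. It is
    gained by self-improvement: the estimate holds on all balls, hence a
    John-Nirenberg argument applies ([jn_iter]). The small exceptional set of a ball
    is covered by balls in which it occupies a share bounded away from [0] and from [1];
    these have small total measure, and their constants are comparable to that of the
    original ball. Iterating yields geometrically decaying tails with a ratio as small
    as desired, hence finite [L^r] averages ([sharp_avg_tails]). As
    [T f] may be non-measurable, exceptional sets are given by measurable covers.

    The covering argument rests on a greedy Vitali selection ([vitali]), where hulls
    play the role of dilated balls, and on a weak density theorem ([density]). *)

(** * Vitali covering and Lebesgue density for ball-bases *)

Section covering.
Context {R : realType} {d : measure_display} {X : measurableType d}
        {mu : {measure set X -> \bar R}}.
Variable BB : ball_basis mu.
Local Notation K := (hull_const BB).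
Implicit Types (A B E : set X) (D : set (set X)).

Definition doubling_at (eta : R) := forall B, balls BB B -> hull BB B <> setT ->
  exists B', [/\ balls BB B', B `<=` B', 2%:E * mu B <= mu B' &
                 mu B' <= eta%:E * mu B].

Lemma ball_fine B : balls BB B -> mu B = (fine (mu B))%:E.
Proof.
move=> bB; rewrite fineK// ge0_fin_numE//.
exact: balls_measure_lty bB.
Qed.

Lemma ball_fine_gt0 B : balls BB B -> (0 < fine (mu B))%R.
Proof. by move=> bB; rewrite -lte_fin -ball_fine//; exact: balls_measure_gt0 bB. Qed.

Lemma ball_nonempty B : balls BB B -> B !=set0.
Proof.
move=> bB; apply/set0P/eqP => B0; have := balls_measure_gt0 bB.
by rewrite B0 measure0 ltxx.
Qed.

Lemma sub_hull A B : balls BB A -> balls BB B -> mu A <= 2%:E * mu B ->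
  A `&` B !=set0 -> A `<=` hull BB B.
Proof. by move=> bA bB AB AB0 x Ax; apply: (hull_sub bB); exists A. Qed.

Lemma sub_hull_self B : balls BB B -> B `<=` hull BB B.
Proof.
move=> bB; apply: sub_hull => //; last first.
  by rewrite setIid; exact: ball_nonempty.
by rewrite ball_fine// -EFinM lee_fin ler_peMl ?ler1n// ltW// ball_fine_gt0.
Qed.

Lemma hull_const_ge1 B : balls BB B -> (1 <= K)%R.
Proof.
move=> bB; have bB' := hull_balls bB.
have : mu B <= mu (hull BB B).
  by apply: le_measure; rewrite ?inE; [exact: balls_measurable bB|
    exact: balls_measurable bB'|exact: sub_hull_self].
move=> /le_trans /(_ (hull_measure bB)).
by rewrite ball_fine// -EFinM lee_fin ler_pMl// ball_fine_gt0.
Qed.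

(** Greedy selection: at each stage a member disjoint from the previous ones
    is taken whose measure is at least half of the largest available. A member
    disjoint from all selected ones would keep all of them large, against the
    finite measure of [S]; so each member meets a first selected one, which is at
    least half as large and therefore has it in its hull. *)
Lemma vitali D (S : set X) : measurable S -> mu S < +oo ->
  (forall A, D A -> balls BB A /\ A `<=` S) ->
  exists A : nat -> set X, [/\ forall n, A n = set0 \/ D (A n),
    trivIset setT A &
    forall B, D B -> exists2 n, D (A n) & B `<=` hull BB (A n)].
Proof.
move=> mS Sfin DS.
have muDS A : D A -> mu A <= mu S.
  by move=> DA; have [bA AS] := DS _ DA; apply: le_measure => //;
    rewrite inE//; exact: balls_measurable bA.
pose good U G := [/\ D G, G `&` U = set0 &
  forall B, D B -> B `&` U = set0 -> mu B <= 2%:E * mu G].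
have /choice[g gP] U : exists G, good U G \/
    G = set0 /\ ~ (exists B, D B /\ B `&` U = set0).
  have [[B0 [DB0 B0U]]|nB] := pselect (exists B, D B /\ B `&` U = set0); last first.
    by exists set0; right.
  pose m := ereal_sup [set mu B | B in [set B | D B /\ B `&` U = set0]].
  have m_ge B : D B -> B `&` U = set0 -> mu B <= m.
    by move=> DB BU; apply: ereal_sup_ubound; exists B.
  have m_gt0 : 0 < m.
    by apply: lt_le_trans (m_ge _ DB0 B0U); have [/balls_measure_gt0] := DS _ DB0.
  have m_fin : m \is a fin_num.
    rewrite ge0_fin_numE ?ltW//; apply: le_lt_trans Sfin.
    by apply: ge_ereal_sup => _ [B [DB _] <-]; exact: muDS.
  have m2 : (0 < fine m / 2)%R by rewrite divr_gt0// fine_gt0// m_gt0 ltey_eq m_fin.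
  have [_ [G [DG GU] <-] mG] := ub_ereal_sup_adherent m2 m_fin.
  exists G; left; split=> // B DB BU; apply: (le_trans (m_ge _ DB BU)).
  have [bG _] := DS _ DG; move: mG.
  rewrite -/m -(fineK m_fin) (ball_fine bG) -EFinB -EFinM lte_fin lee_fin; lra.
pose U n := iter n (fun V => V `|` g V) set0.
pose A n := g (U n).
have AU i j : (i < j)%N -> A i `<=` U j.
  elim: j => // j IHj; rewrite ltnS leq_eqVlt => /predU1P[->|/IHj AUj] x Ax.
    by right.
  by left; exact: AUj.
have AD n : A n = set0 \/ D (A n).
  by rewrite /A; have [[? _ _]|[-> _]] := gP (U n); [right|left].
have A0 n : A n `&` U n = set0.
  by have [[]|[gU _]] := gP (U n) => //; rewrite /A gU set0I.
have UA j x : U j x -> exists2 i, (i < j)%N & A i x.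
  elim: j => // j IHj [/IHj[i ij Aix]|gx]; first by exists i => //; exact: ltnW.
  by exists j.
have tA : trivIset setT A.
  apply: ltn_trivIset => j i ij; apply/seteqP; split=> // x [Aix Ajx].
  by rewrite -(A0 j); split=> //; exact: (AU i j ij).
exists A; split=> // B DB; have [bB BS] := DS _ DB.
have mA n : measurable (A n).
  case: (AD n) => [->//|/DS[bA _]]; exact: balls_measurable bA.
have [disj|] := pselect (forall n, B `&` A n = set0).
  have BU n : B `&` U n = set0.
    apply/seteqP; split=> // x [Bx /UA[i _ Aix]].
    by rewrite -(disj i).
  have large n : mu B <= 2%:E * mu (A n).
    by have [[_ _]|[_ []]] := gP (U n); [exact|exists B].
  have c0 := ball_fine_gt0 bB.
  have [N HN] : exists N : nat, (fine (mu S) < fine (mu B) / 2 * N%:R)%R.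
    exists (Num.trunc (fine (mu S) / (fine (mu B) / 2))).+1.
    rewrite -ltr_pdivrMl ?divr_gt0// mulrC; exact: truncnS_gt.
  exfalso; have : (fine (mu B) / 2 * N%:R)%:E <= mu S.
    apply: (@le_trans _ _ (\sum_(0 <= i < N) mu (A i))).
      rewrite mulr_natr -[in leLHS](subn0 N) -sumr_const_nat -sumEFin; apply: lee_sum => i _.
      have := large i; have : mu (A i) <= mu S.
        by case: (AD i) => [->|/muDS//]; rewrite measure0.
      move=> /le_lt_trans /(_ Sfin) Aifin; rewrite -(@fineK _ (mu (A i))) ?ge0_fin_numE//.
      rewrite (ball_fine bB) -EFinM !lee_fin/=; lra.
    apply: (@le_trans _ _ (\sum_(0 <= i <oo) mu (A i))); first exact: nneseries_lim_ge.
    rewrite -measure_semi_bigcup//; last exact: bigcup_measurable.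
    apply: le_measure; rewrite ?inE//; first exact: bigcup_measurable.
    by move=> x [i _ Aix]; case: (AD i) => [Ai0|/DS[_]]; [rewrite Ai0 in Aix|exact].
  rewrite -(@fineK _ (mu S)) ?ge0_fin_numE// lee_fin; lra.
move=> /existsNP ex.
have {}ex : exists n, `[< B `&` A n !=set0 >].
  by case: ex => n /eqP/set0P BA; exists n; exact/asboolP.
case: (ex_minnP ex) => n /asboolP BAn nmin.
have BU : B `&` U n = set0.
  apply/seteqP; split=> // x [Bx /UA[i lt_in Aix]].
  have : (n <= i)%N by apply: nmin; apply/asboolP; exists x.
  by rewrite leqNgt lt_in.
have [[DA _ /(_ _ DB BU) muBA]|[A0' _]] := gP (U n); last first.
  by case: BAn; rewrite /A A0' => x [].
by exists n => //; apply: sub_hull => //; have [] := DS _ DA.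
Qed.

End covering.

Section density.
Context {R : realType} {d : measure_display} {X : measurableType d}
        {mu : {measure set X -> \bar R}}.
Variable BB : ball_basis mu.
Local Notation K := (hull_const BB).
Implicit Types (A B E : set X) (D : set (set X)).

Lemma le_double_of_half (x y : \bar R) : 0 <= y -> y < +oo ->
  2%:E * y <= x + y -> x + y <= 2%:E * x.
Proof.
case: y => [y| |]// _ _; case: x => [x| |] h.
- by move: h; rewrite -!EFinD -!EFinM !lee_fin; lra.
- by rewrite gt0_muley ?lte_fin// leey.
- by rewrite leNye.
Qed.

(** The form in which [vitali] is used: if each member of [D] has a fixed share of
    its mass in [T], disjointness bounds the selected balls, hence their hulls, by
    the measure of [T]. *)
Lemma hull_cover D (S T : set X) (k : R) : measurable S -> mu S < +oo ->
  measurable T -> (0 <= k)%R ->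
  (forall A, D A -> [/\ balls BB A, A `<=` S & mu A <= k%:E * mu (A `&` T)]) ->
  exists H : nat -> set X, [/\
    forall n, H n = set0 \/ exists2 A, D A & H n = hull BB A,
    \sum_(0 <= n <oo) mu (H n) <= (K * k)%:E * mu T &
    forall B, D B -> B `<=` \bigcup_n H n].
Proof.
move=> mS Sfin mT k0 DS.
have [|A [AD tA Acov]] := @vitali _ _ _ _ BB D S mS Sfin.
  by move=> A /DS[].
(* Empty sets of the selection are kept empty, as [hull BB set0] is arbitrary. *)
pose H n := if `[< A n = set0 >] then set0 else hull BB (A n).
have Hset0 n : A n = set0 -> H n = set0 by move=> ?; rewrite /H asboolT.
have Hhull n : D (A n) -> H n = hull BB (A n).
  move=> /DS[bA _ _]; rewrite /H asboolF// => A0.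
  by have := ball_nonempty bA; rewrite A0 => -[].
have mA n : measurable (A n).
  by case: (AD n) => [->//|/DS[bA _ _]]; exact: balls_measurable bA.
exists H; split.
- by move=> n; case: (AD n) => [/Hset0|DA]; [left|right; exists (A n) => //; exact: Hhull].
- have K0 := hull_const_gt0 BB.
  apply: (@le_trans _ _ (\sum_(0 <= n <oo) (K * k)%:E * mu (A n `&` T))).
    apply: lee_nneseries => // n _.
    case: (AD n) => [An0|DA].
      by rewrite Hset0// measure0 mule_ge0// lee_fin mulr_ge0// ltW.
    have [bA _ Ak] := DS _ DA; rewrite Hhull//.
    apply: (le_trans (hull_measure bA)); rewrite EFinM -muleA.
    by rewrite lee_pmul2l ?lte_fin.
  rewrite nneseriesZl// lee_wpmul2l ?lee_fin ?mulr_ge0 ?(ltW K0)//.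
  have mAT n : measurable (A n `&` T) by exact: measurableI.
  rewrite -(@measure_semi_bigcup _ _ _ mu (fun n => A n `&` T))//; last 2 first.
  + exact: trivIset_setIr.
  + exact: bigcup_measurable.
  apply: le_measure; rewrite ?inE//; first exact: bigcup_measurable.
  by move=> x [n _ []].
- by move=> B /Acov[n DA BA] x /BA hx; exists n => //; rewrite Hhull.
Qed.

Lemma negligible_small E :
  (forall e : R, (0 < e)%R -> exists W, [/\ measurable W, E `<=` W & mu W <= e%:E]) ->
  mu.-negligible E.
Proof.
move=> HE.
have /choice[W HW] (n : nat) : exists W, [/\ measurable W, E `<=` W & mu W <= (n.+1%:R^-1)%:E].
  by apply: HE; rewrite invr_gt0.
have mW : measurable (\bigcap_n W n) by apply: bigcapT_measurable => n; case: (HW n).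
exists (\bigcap_n W n); split=> //; last by move=> x Ex n _; case: (HW n) => _ EW _; exact: EW.
apply/eqP; rewrite eq_le measure_ge0 andbT; apply/lee_addgt0Pr => e e0; rewrite add0e.
have [n ne] : exists n : nat, (n.+1%:R^-1 < e)%R.
  exists (Num.trunc e^-1); rewrite invf_plt ?posrE//; exact: truncnS_gt.
apply: (@le_trans _ _ (mu (W n))).
  apply: le_measure; rewrite ?inE//; [by case: (HW n)|by move=> x /(_ n I)].
by case: (HW n) => _ _ /le_trans; apply; rewrite lee_fin ltW.
Qed.

(** A weak form of the Lebesgue density theorem, which is where the approximation
    of measurable sets by unions of balls enters: cover [Om] up to [e] by balls;
    those in which [Om] has at most half of the mass have the other half outside
    [Om], so disjoint ones have total measure at most [2 * e], and their hulls
    still have measure [O(e)]. *)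
Lemma density (Om : set X) : measurable Om -> mu Om < +oo ->
  mu.-negligible [set x | Om x /\
    forall A, balls BB A -> A x -> 2%:E * mu (A `&` Om) <= mu A].
Proof.
move=> mO Ofin; apply: negligible_small => e e0.
have K0 := hull_const_gt0 BB.
(* The uncovered part of [Om] costs [e1], the hulls [2 * K * e1]. *)
pose e1 := (e / (1 + K * 2))%R.
have e10 : (0 < e1)%R by rewrite divr_gt0// addr_gt0// mulr_gt0.
have [D [F [FB FO]]] := balls_approx BB mO e10.
pose S := \bigcup_(k in D) F k.
have mF k : D k -> measurable (F k) by move=> /FB bF; exact: balls_measurable bF.
have mS : measurable S by exact: bigcup_measurable.
have mOS : measurable (Om `\` S) by exact: measurableD.
have mSO : measurable (S `\` Om) by exact: measurableD.
have OSe : mu (Om `\` S) + mu (S `\` Om) <= e1%:E.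
  rewrite -measureU//; first exact: ltW FO.
  by apply/seteqP; split=> // x [[_ nSx] [Sx _]].
have OS_le : mu (Om `\` S) <= e1%:E.
  by apply: le_trans OSe; rewrite leeDl.
have SO_le : mu (S `\` Om) <= e1%:E.
  by apply: le_trans OSe; rewrite leeDr.
have Sfin : mu S < +oo.
  have : mu S <= mu (Om `|` (S `\` Om)).
    apply: le_measure; rewrite ?inE//; first exact: measurableU.
    by move=> x Sx; case: (pselect (Om x)) => Ox; [left|right].
  move=> /le_lt_trans; apply; apply: (le_lt_trans (measureU2 _ _ _)) => //.
  by rewrite lte_add_pinfty// (le_lt_trans SO_le) ?ltry.
pose G A := (exists2 k, D k & A = F k) /\ 2%:E * mu (A `&` Om) <= mu A.
have [//|A [[k Dk ->] half]|H [HG Hsum Hcov]] :=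
    @hull_cover G S (S `\` Om) 2 mS Sfin mSO.
- split; [exact: FB|by move=> x Fx; exists k|].
  have -> : F k `&` (S `\` Om) = F k `\` Om.
    by apply/seteqP; split=> [x [? []]//|x [Fx nO]]; do 2?split=> //; exists k.
  have bF := FB k Dk; move: half; rewrite (measureDI mu (mF k Dk) mO).
  have : mu (F k `&` Om) < +oo.
    apply: (@le_lt_trans _ _ (mu (F k))); last exact: balls_measure_lty bF.
    by apply: le_measure; rewrite ?inE//; [apply: measurableI => //; exact: mF|exact: mF].
  by move=> Ffin half; exact: le_double_of_half Ffin half.
exists ((Om `\` S) `|` \bigcup_n H n).
have mH n : measurable (H n).
  case: (HG n) => [->//|[_ [[k Dk ->] _] ->]].
  exact/(balls_measurable (b := BB))/hull_balls/FB.
have mUH : measurable (\bigcup_n H n) by exact: bigcup_measurable.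
split; first exact: measurableU.
  move=> x [Ox xlow]; have [[k Dk Fx]|nSx] := pselect (S x); last by left.
  right; apply: (Hcov (F k)) => //; split; first by exists k.
  by apply: xlow => //; exact: FB.
apply: (le_trans (measureU2 _ _ _)) => //.
apply: (@le_trans _ _ (e1%:E + (K * 2)%:E * e1%:E)).
  apply: leeD => //; apply: (le_trans (measure_sigma_subadditive mu mH mUH _)) => //.
  apply: (le_trans Hsum); rewrite lee_wpmul2l// lee_fin mulr_ge0// ltW//.
rewrite -EFinM -EFinD lee_fin /e1 -[X in (X + _)%R]mul1r -mulrDl mulrC divfK//.
by rewrite gt_eqF// addr_gt0// mulr_gt0.
Qed.
End density.

(** * The John-Nirenberg inequality *)

Section john_nirenberg.
Context {R : realType} {d : measure_display} {X : measurableType d}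
        {mu : {measure set X -> \bar R}}.
Variable BB : ball_basis mu.
Local Notation K := (hull_const BB).
Implicit Types (A B E : set X) (F : X -> \bar R) (c : set X -> R).

Lemma lee_dist_recenter (y : \bar R) (a b u v : R) :
  `|y - a%:E| <= u%:E -> (`|a - b| <= v)%R -> `|y - b%:E| <= (u + v)%:E.
Proof.
case: y => [y| |]//=; rewrite !lee_fin => yu ab.
by rewrite (le_trans (ler_distD a y b))// lerD.
Qed.

Lemma ler_dist_centers (y : \bar R) (a b u v : R) :
  `|y - a%:E| <= u%:E -> `|y - b%:E| <= v%:E -> (`|a - b| <= u + v)%R.
Proof.
case: y => [y| |]//=; rewrite !lee_fin => yu ab.
by rewrite (le_trans (ler_distD y a b))// distrC lerD.
Qed.

(** Along a chain of balls growing by factors in [[2, eta]], the last one in which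
    [Om] is the majority is followed by one in which its share lies between
    [1 / (2 * eta)] and [1 / 2]. The chain cannot end at a ball whose hull is the
    whole space, as [Om] is too small for that. *)
Lemma balanced_ball (eta : R) (Om A : set X) : (2 < eta)%R ->
  doubling_at BB eta ->
  measurable Om -> (2 * K)%:E * mu Om < mu setT -> balls BB A ->
  mu A < 2%:E * mu (A `&` Om) ->
  exists A', [/\ balls BB A', A `<=` A', mu A' <= (2 * eta)%:E * mu (A' `&` Om) &
                 2%:E * mu (A' `&` Om) <= mu A'].
Proof.
move=> eta2 dbl mO Osmall bA Amaj.
have K0 := hull_const_gt0 BB.
have Ofin : mu Om \is a fin_num.
  rewrite ge0_fin_numE//; case: (mu Om) (measure_ge0 mu Om) Osmall => [a| |]// _; first by rewrite ltry.
  by rewrite gt0_muley ?lte_fin ?mulr_gt0// ltNge leey.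
have mBO B : balls BB B -> measurable (B `&` Om).
  by move=> bB; apply: measurableI => //; exact: balls_measurable bB.
have muBO B : balls BB B -> mu (B `&` Om) = (fine (mu (B `&` Om)))%:E.
  move=> bB; rewrite fineK// ge0_fin_numE//.
  apply: le_lt_trans (balls_measure_lty bB).
  by apply: le_measure; rewrite ?inE//; [exact: mBO|exact: balls_measurable bB].
have muBO_le B : balls BB B -> (fine (mu (B `&` Om)) <= fine (mu Om))%R.
  move=> bB; rewrite -lee_fin -muBO// fineK//.
  by apply: le_measure; rewrite ?inE//; exact: mBO.
(* The induction is on the number of doublings after which the ball outgrows [Om]. *)
have [n] : exists n : nat, (2 * fine (mu Om) < 2 ^+ n * fine (mu A))%R.
  have A0 := ball_fine_gt0 bA.
  exists (Num.trunc (2 * fine (mu Om) / fine (mu A))).+1.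
  rewrite -ltr_pdivrMr//; apply: (lt_le_trans (truncnS_gt _)).
  by rewrite -natrX ler_nat; exact/ltnW/ltn_expl.
elim: n => [|n IHn] in A bA Amaj *.
  rewrite expr0 mul1r => lt1; exfalso; move: Amaj.
  have := muBO_le _ bA.
  by rewrite (muBO _ bA) (ball_fine bA) -EFinM lte_fin; lra.
move=> lt1; have [hT|/(dbl _ bA)[A' [bA' AA' le1 le2]]] := pselect (hull BB A = setT).
  exfalso; move: Osmall; apply/negP; rewrite -leNgt -hT.
  apply: (le_trans (hull_measure bA)); move: Amaj (muBO_le _ bA).
  rewrite (muBO _ bA) (ball_fine bA) -[mu Om](fineK Ofin) -!EFinM lte_fin lee_fin => l1 l2.
  by rewrite -mulrA mulrCA ler_pM2l//; lra.
have sub : (fine (mu (A `&` Om)) <= fine (mu (A' `&` Om)))%R.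
  rewrite -lee_fin -!muBO//; apply: le_measure; rewrite ?inE; [exact: mBO|exact: mBO|].
  by move=> x [/AA' ? ?].
move: Amaj le1 le2; rewrite (muBO _ bA) (ball_fine bA) (ball_fine bA').
rewrite -!EFinM lte_fin !lee_fin => l1 l2 l3.
have [half|] := leP (2%:E * mu (A' `&` Om)) (mu A').
  exists A'; split => //; move: half; rewrite (muBO _ bA') (ball_fine bA').
  rewrite -!EFinM !lee_fin => _; apply: (le_trans l3).
  by rewrite -mulrA [leRHS]mulrCA ler_wpM2l//; lra.
move=> /(IHn _ bA')[|A'' [? A'A'' ? ?]].
  by apply: (lt_le_trans lt1); rewrite exprSr -mulrA ler_wpM2l// exprn_ge0.
by exists A''; split => //; exact: subset_trans A'A''.
Qed.

(** One step of the Calderon-Zygmund type decomposition behind the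
    John-Nirenberg inequality. By [density] and [balanced_ball] almost all of the
    exceptional set of [B] is covered by balanced balls [A], and by [hull_cover] by
    hulls of total measure at most [q * mu B]. As [Om B] fills at most half of [A]
    and [Om (hull A)] less than half, a point of [A] outside both compares the
    constants of [B] and of [hull A]. The estimate is assumed on [hull BB B] rather
    than on [B] because a balanced ball meeting [B] may stick out of [B]. *)
Lemma jn_step (eta kap lam q : R) F c (Om : set X -> set X) : (2 < eta)%R ->
  doubling_at BB eta ->
  (0 < kap)%R -> (4 * K * eta * kap <= q)%R -> (q <= 1)%R ->
  (forall B, balls BB B -> [/\ measurable (Om B), mu (Om B) <= kap%:E * mu B &
     forall x, hull BB B x -> ~ Om B x -> `|F x - (c B)%:E| <= lam%:E]) ->
  forall B, balls BB B -> exists (H : nat -> set X) (N : set X),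
    [/\ mu.-negligible N,
        forall n, H n = set0 \/ balls BB (H n) /\ (`|c (H n) - c B| <= lam + lam)%R,
        \sum_(0 <= n <oo) mu (H n) <= q%:E * mu B &
        B `&` Om B `<=` N `|` \bigcup_n H n].
Proof.
move=> eta2 dbl kap0 kapq q1 good B bB.
have [mO Ole Fle] := good _ bB.
have K0 := hull_const_gt0 BB.
have K1 := hull_const_ge1 bB.
have b0 := ball_fine_gt0 bB.
have mB := balls_measurable bB.
have mhB := balls_measurable (hull_balls bB).
have Kk : (0 < K * kap)%R by rewrite mulr_gt0.
have Kek : (K * kap * 2 < K * kap * eta)%R by rewrite ltr_pM2l.
have Kek1 : (K * kap * eta <= 4^-1)%R.
  by move: (le_trans kapq q1); rewrite -!mulrA (mulrC eta); lra.
have ek1 : (eta * kap <= 1)%R.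
  apply: (@le_trans _ _ (K * kap * eta)%R); last by lra.
  by rewrite -mulrA (mulrC kap) ler_peMl// mulr_ge0//; lra.
pose T := Om B.
have Ofin : mu T < +oo.
  by apply: (le_lt_trans Ole); rewrite (ball_fine bB) -EFinM ltry.
have Osmall : (2 * K)%:E * mu T < mu setT.
  apply: (@lt_le_trans _ _ (mu B)); last first.
    by apply: le_measure; rewrite ?inE.
  apply: (@le_lt_trans _ _ ((2 * K)%:E * (kap%:E * mu B))).
    by rewrite lee_wpmul2l// lee_fin mulr_ge0// ltW.
  rewrite (ball_fine bB) -!EFinM lte_fin mulrA gtr_pMl//; lra.
pose D A := [/\ balls BB A, A `&` B !=set0, mu A <= (2 * eta)%:E * mu (A `&` T) &
                2%:E * mu (A `&` T) <= mu A].
have D_sub A : D A -> A `<=` hull BB B.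
  move=> [bA AB Ale _]; apply: sub_hull => //; apply: (le_trans Ale).
  apply: (@le_trans _ _ ((2 * eta)%:E * (kap%:E * mu B))).
    rewrite lee_wpmul2l ?lee_fin//; first by lra.
    apply: le_trans Ole; apply: le_measure; rewrite ?inE//.
    by apply: measurableI => //; exact: balls_measurable bA.
  rewrite (ball_fine bB) -!EFinM lee_fin mulrA ler_wpM2r ?(ltW b0)//; lra.
have D_const A : D A -> (`|c (hull BB A) - c B| <= lam + lam)%R.
  move=> DA; have [bA AB _ Ahalf] := DA.
  have bhA := hull_balls bA.
  have [mO' O'le F'le] := good _ bhA.
  have [y [Ay nBy nAy]] : exists y, [/\ A y, ~ T y & ~ Om (hull BB A) y].
    apply: contrapT => /forallNP noy.
    have : mu A <= mu (A `&` T) + mu (Om (hull BB A)).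
      apply: le_trans (measureU2 _ _ _) => //; last first.
        by apply: measurableI => //; exact: balls_measurable bA.
      apply: le_measure; rewrite ?inE; [exact: balls_measurable bA| |].
        by apply: measurableU => //; apply: measurableI => //; exact: balls_measurable bA.
      move=> y Ay; have [Ty|nTy] := pselect (T y); first by left.
      by right; apply: contrapT => nOy; apply: (noy y).
    have : mu (Om (hull BB A)) <= (kap * K)%:E * mu A.
      apply: (le_trans O'le); rewrite EFinM -muleA lee_wpmul2l ?lee_fin ?(ltW kap0)//.
      exact: hull_measure.
    have AOfin : mu (A `&` T) \is a fin_num.
      rewrite ge0_fin_numE//; apply: le_lt_trans (balls_measure_lty bA).
      by apply: le_measure; rewrite ?inE//; [apply: measurableI => //|]; exact: balls_measurable bA.
    have O'fin : mu (Om (hull BB A)) \is a fin_num.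
      rewrite ge0_fin_numE//; apply: (le_lt_trans O'le).
      by rewrite (ball_fine bhA) -EFinM ltry.
    have := ball_fine_gt0 bA; move: Ahalf.
    rewrite (ball_fine bA) -(fineK AOfin) -(fineK O'fin).
    rewrite -!EFinM -EFinD !lee_fin; set a := fine (mu A) => l1 a0 l2 l3.
    have : (kap * K * a <= 4^-1 * a)%R by rewrite ler_wpM2r ?(ltW a0)// mulrC; lra.
    by move: a0 => /= a0; lra.
  apply: (@ler_dist_centers (F y)); last by apply: Fle => //; exact: D_sub Ay.
  by apply: F'le => //; apply: sub_hull_self => //; exact: sub_hull_self Ay.
have [|||H [HD Hsum Hcov]] := @hull_cover _ _ _ _ BB D (hull BB B) T (2 * eta) mhB _ mO.
- exact/balls_measure_lty/hull_balls.
- lra.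
- by move=> A DA; have [bA _ Ale _] := DA; split => //; exact: D_sub.
exists H, [set x | T x /\ forall A, balls BB A -> A x -> 2%:E * mu (A `&` T) <= mu A].
split; first exact: density.
- move=> n; case: (HD n) => [|[A DA ->]]; [by left|right].
  by split; [have [/hull_balls] := DA|exact: D_const].
- apply: (le_trans Hsum); apply: (@le_trans _ _ ((K * (2 * eta))%:E * (kap%:E * mu B))).
    by rewrite lee_wpmul2l// lee_fin mulr_ge0 ?ltW// mulr_gt0//; lra.
  rewrite (ball_fine bB) -!EFinM lee_fin mulrA ler_wpM2r ?(ltW b0)//.
  apply: le_trans kapq; rewrite -subr_ge0.
  have -> : (4 * K * eta * kap - K * (2 * eta) * kap = 2 * (K * kap * eta))%R by ring.
  by rewrite mulr_ge0// ltW//; lra.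
- move=> x [Bx Tx]; have [low|] := pselect (forall A, balls BB A -> A x ->
    2%:E * mu (A `&` T) <= mu A); first by left.
  move=> /existsNP[A /not_implyP[bA /not_implyP[Ax /negP]]]; rewrite -ltNge => Amaj.
  have [A' [bA' AA' le1 le2]] := balanced_ball eta2 dbl mO Osmall bA Amaj.
  by right; apply: (Hcov A'); [split => //; exists x; split => //|]; exact: AA'.
Qed.

(** The John-Nirenberg inequality: one passage from a ball to the balls of [jn_step]
    costs [lam + lam] in the bound and gains a factor [q] in the measure of the set
    where the bound may fail. *)
Lemma jn_iter (eta kap lam q : R) F c (Om : set X -> set X) : (2 < eta)%R ->
  doubling_at BB eta ->
  (0 < kap)%R -> (4 * K * eta * kap <= q)%R -> (q <= 1)%R -> (0 <= lam)%R ->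
  (forall B, balls BB B -> [/\ measurable (Om B), mu (Om B) <= kap%:E * mu B &
     forall x, hull BB B x -> ~ Om B x -> `|F x - (c B)%:E| <= lam%:E]) ->
  forall n B, balls BB B -> exists E, [/\ measurable E,
    mu E <= (q ^+ n)%:E * mu B &
    forall x, B x -> ~ E x -> `|F x - (c B)%:E| <= ((lam + lam) *+ n)%:E].
Proof.
move=> eta2 dbl kap0 kapq q1 lam0 good.
have q0 : (0 <= q)%R.
  by apply: le_trans kapq; rewrite !mulr_ge0 ?(ltW kap0) ?(ltW (hull_const_gt0 BB))//; lra.
elim=> [|n IHn] B bB.
  by exists B; rewrite expr0 mul1e; split => //; exact: balls_measurable bB.
have [H [N [[N' [mN' N'0 NN']] HB Hsum Hcov]]] :=
  jn_step eta2 dbl kap0 kapq q1 good bB.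
have /choice[E HE] k : exists E, [/\ measurable E, mu E <= (q ^+ n)%:E * mu (H k) &
    forall x, H k x -> ~ E x -> `|F x - (c B)%:E| <= ((lam + lam) *+ n.+1)%:E].
  case: (HB k) => [->|[bH cH]].
    by exists set0; rewrite measure0 mule0.
  have [E [mE muE FE]] := IHn _ bH; exists E; split=> // x Hx nEx.
  by rewrite mulrSr; apply: lee_dist_recenter (FE x Hx nEx) cH.
have mE k : measurable (E k) by case: (HE k).
have mUE : measurable (\bigcup_k E k) by exact: bigcup_measurable.
exists (N' `|` \bigcup_k E k); split; first exact: measurableU.
  apply: (le_trans (measureU2 _ _ _)) => //.
  rewrite [X in X + _](_ : _ = 0) ?add0e; last exact: N'0.
  apply: (le_trans (measure_sigma_subadditive mu mE mUE _)) => //.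
  apply: (@le_trans _ _ (\sum_(0 <= k <oo) (q ^+ n)%:E * mu (H k))).
    by apply: lee_nneseries => // k _; case: (HE k).
  rewrite nneseriesZl// exprSr EFinM -muleA lee_wpmul2l// lee_fin exprn_ge0//.
move=> x Bx /not_orP[nN' nE]; have [Ox|nOx] := pselect (Om B x).
  have [/NN'//|[k _ Hkx]] := Hcov x (conj Bx Ox).
  by have [_ _] := HE k; apply => // Ekx; apply: nE; exists k.
have [_ _ Fle] := good _ bB.
apply: (le_trans (Fle x _ nOx)); first exact: sub_hull_self.
by rewrite lee_fin mulrS -addrA lerDl addr_ge0// mulrn_wge0// addr_ge0.
Qed.

End john_nirenberg.

(** * Averages of functions with geometrically decaying tails *)

Section tail_integrals.
Context {R : realType}.

(** The integral of a nonnegative function is by definition a supremum over the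
    simple functions below it, whence monotonicity for arbitrary functions. *)
Lemma ge0_le_integral_any d (Y : measurableType d) (m : {measure set Y -> \bar R})
    (D : set Y) (f g : Y -> \bar R) :
  (forall y, D y -> 0 <= f y) -> (forall y, D y -> f y <= g y) ->
  \int[m]_(y in D) f y <= \int[m]_(y in D) g y.
Proof.
move=> f0 fg; rewrite integral_mkcond [leRHS]integral_mkcond.
have fgD y : (f \_ D) y <= (g \_ D) y.
  by rewrite !patchE; case: ifPn => // /set_mem; exact: fg.
have f0D y : 0 <= (f \_ D) y.
  by rewrite patchE; case: ifPn => // /set_mem; exact: f0.
rewrite !ge0_integralTE//; last by move=> y; exact: le_trans (fgD y).
by apply: le_ereal_sup => _ [h hf <-]; exists h => // y; exact: le_trans (fgD y).
Qed.

Lemma term_le_nneseries (u : (\bar R)^nat) n : (forall k, 0 <= u k) ->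
  u n <= \sum_(0 <= k <oo) u k.
Proof.
move=> u0; apply: le_trans (nneseries_lim_ge n.+1 _) => //.
by rewrite big_nat_recr//= leeDr// sume_ge0.
Qed.

Lemma integral_le_steps d (Y : measurableType d) (m : {measure set Y -> \bar R})
    (D : set Y) (f : Y -> \bar R) (S : nat -> set Y) (a : nat -> R) :
  measurable D -> (forall n, measurable (S n)) -> (forall n, (0 <= a n)%R) ->
  (forall y, D y -> 0 <= f y) ->
  (forall y, D y -> f y <= \sum_(0 <= n <oo) (a n)%:E * (\1_(S n) y)%:E) ->
  \int[m]_(y in D) f y <= \sum_(0 <= n <oo) (a n)%:E * m (S n `&` D).
Proof.
move=> mD mS a0 f0 fle; apply: (le_trans (@ge0_le_integral_any _ _ m D f _ f0 fle)).
have mind n : measurable_fun D (fun y => (\1_(S n) y)%:E : \bar R).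
  by apply/measurable_EFinP/measurable_funTS; exact: measurable_indic.
rewrite integral_nneseries//; last 2 first.
- by move=> n; apply: emeasurable_funM => //; exact: measurable_cst.
- by move=> n y _; rewrite mule_ge0// lee_fin.
apply: lee_nneseries => [n _ _|n _].
- by apply: integral_ge0 => y _; rewrite mule_ge0// lee_fin.
- rewrite ge0_integralZl ?lee_fin//.
  by rewrite integral_indic.
Qed.

Lemma nneseries_half_le (b : R) (u : nat -> \bar R) : (0 <= b)%R ->
  (forall n, 0 <= u n) -> (forall n, u n <= (b / 2 ^+ n)%:E) ->
  \sum_(0 <= n <oo) u n <= (2 * b)%:E.
Proof.
move=> b0 u0 ub; apply: le_trans (@epsilon_trick0 R (2 * b)%R xpredT _).
  apply: lee_nneseries => // n _; apply: (le_trans (ub n)).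
  by rewrite lee_fin natrX exprS invfM mulrACA divff// mul1r.
by rewrite mulr_ge0.
Qed.

(** The ratio [2 `^ (- (r + 1))] beats the [r]-th powers of the levels, as
    [n.+1 <= 2 ^+ n]. *)
Lemma polynomial_geometric_le (p r : R) n : (0 <= p <= r)%R ->
  (n.+1%:R `^ p * (2 `^ (- (r + 1))) ^+ n <= (2 ^+ n)^-1)%R.
Proof.
move=> /andP[p0 pr].
have n2 : (n.+1%:R <= 2 `^ n%:R :> R)%R.
  by rewrite powR_mulrn// -natrX ler_nat; exact: ltn_expl.
apply: (@le_trans _ _ ((2 `^ n%:R) `^ p * (2 `^ (- (r + 1))) ^+ n)%R).
  by rewrite ler_wpM2r ?exprn_ge0 ?powR_ge0// ge0_ler_powR ?nnegrE ?powR_ge0.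
rewrite -powR_mulrn ?powR_ge0// -!powRrM -powRD; last by rewrite pnatr_eq0 implybT.
rewrite -[in leRHS]powR_mulrn// -powRN ler_powR ?ler1n// -subr_ge0.
have -> : (- n%:R - (n%:R * p + - (r + 1) * n%:R) = n%:R * (r - p))%R by ring.
by rewrite mulr_ge0// subr_ge0.
Qed.

End tail_integrals.

Section tails.
Context {R : realType} {d : measure_display} {X : measurableType d}
        {mu : {measure set X -> \bar R}}.
Implicit Types (F : X -> \bar R) (B E : set X) (r p q c L : R).

(** Exceptional sets instead of distribution functions, since [F] may be
    non-measurable. *)
Definition tails q F B c L := forall n : nat, exists E, [/\ measurable E,
  mu E <= (q ^+ n)%:E * mu B &
  forall x, B x -> ~ E x -> `|F x - c%:E| <= (L *+ n)%:E].

Lemma integral_tails p r F B c L : (1 <= p <= r)%R -> (0 < L)%R ->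
  measurable B -> mu B \is a fin_num -> tails (2 `^ (- (r + 1))) F B c L ->
  \int[mu]_(x in B) `|F x - c%:E| `^ p <= (2 * L `^ p)%:E * mu B.
Proof.
move=> /andP[p1 pr] L0 mB Bfin /choice[E HE].
have mE n : measurable (E n) by case: (HE n).
pose a n := ((n.+1%:R * L) `^ p)%R.
have a0 n : (0 <= a n)%R by exact: powR_ge0.
have p0 : (0 < p)%R by exact: lt_le_trans p1.
have pn0 : p != 0%R by rewrite gt_eqF.
have aL n : (L `^ p <= a n)%R.
  rewrite ge0_ler_powR ?nnegrE ?(ltW p0) ?(ltW L0) ?mulr_ge0 ?(ltW L0)//.
  by rewrite ler_peMl ?ler1n// ltW.
pose q := (2 `^ (- (r + 1)))%R.
have b0 : (0 <= fine (mu B))%R by exact: fine_ge0.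
apply: (@le_trans _ _ (\sum_(0 <= n <oo) (a n)%:E * mu (E n `&` B))).
  apply: integral_le_steps => //; first by move=> x _; exact: poweR_ge0.
  move=> x Bx; set u := fun n => (a n)%:E * (\1_(E n) x)%:E.
  have u0 n : 0 <= u n by rewrite mule_ge0// lee_fin.
  (* Either [x] lies in all [E n] and the sum diverges, or the level just before the
     first [E n] missed by [x] already bounds [F x - c]. *)
  have [|/existsNP ex] := pselect (forall n, E n x).
    move=> Ex; rewrite [leRHS](_ : _ = +oo) ?leey//.
    have Lp : (0 < L `^ p)%R by exact: powR_gt0.
    apply: eq_infty => y.
    have [N HN] : exists N : nat, (y <= L `^ p * N%:R)%R.
      exists (Num.trunc (y / L `^ p)).+1.
      by rewrite -ler_pdivrMl// mulrC ltW// truncnS_gt.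
    apply: le_trans (nneseries_lim_ge N _); last by move=> k _ _; exact: u0.
    apply: (@le_trans _ _ (L `^ p * N%:R)%:E); first by rewrite lee_fin.
    rewrite mulr_natr -[in leLHS](subn0 N) -sumr_const_nat -sumEFin; apply: lee_sum => i _.
    by rewrite /u indicE mem_set// mule1 lee_fin.
  have {}ex : exists n, `[< ~ E n x >] by case: ex => n ?; exists n; exact/asboolP.
  have Fle n : ~ E n x -> `|F x - c%:E| <= (L *+ n)%:E.
    by have [_ _] := HE n; apply.
  case: (ex_minnP ex) => -[|n] /asboolP nEx nmin; have {}Fle := Fle _ nEx.
    move: Fle; rewrite mulr0n => Fle.
    have -> : `|F x - c%:E| = 0 by apply/eqP; rewrite eq_le Fle abse_ge0.
    by rewrite poweR_EFin powR0//; apply: nneseries_ge0 => k _ _; exact: u0.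
  have Enx : E n x.
    apply: contrapT => nE; have : (n.+1 <= n)%N by apply: nmin; exact/asboolP.
    by rewrite ltnn.
  apply: le_trans (@term_le_nneseries _ u n u0).
  rewrite /u indicE mem_set// mule1 /a -poweR_EFin; apply: gt0_ler_poweR.
  - exact: ltW.
  - by rewrite in_itv/= abse_ge0 leey.
  - by rewrite in_itv/= leey andbT lee_fin mulr_ge0// ltW.
  - by rewrite mulr_natl.
rewrite -(fineK Bfin) -EFinM -mulrA; apply: nneseries_half_le.
- by rewrite mulr_ge0// powR_ge0.
- by move=> n; rewrite mule_ge0// lee_fin.
- move=> n; have [_ muE _] := HE n.
  apply: (@le_trans _ _ ((a n)%:E * (q ^+ n * fine (mu B))%:E)).
    rewrite lee_wpmul2l ?lee_fin// EFinM fineK//; apply: le_trans muE.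
    by apply: le_measure; rewrite ?inE//; exact: measurableI.
  rewrite -EFinM lee_fin /a powRM ?(ltW L0)//.
  have -> : (n.+1%:R `^ p * L `^ p * (q ^+ n * fine (mu B)) =
    (n.+1%:R `^ p * q ^+ n) * (L `^ p * fine (mu B)))%R by ring.
  rewrite [leRHS]mulrC ler_wpM2r ?mulr_ge0 ?powR_ge0//.
  by apply: polynomial_geometric_le; rewrite pr (ltW p0).
Qed.

End tails.

Section sharp_average.
Context {R : realType} {d : measure_display} {X : measurableType d}
        {mu : {measure set X -> \bar R}}.
Implicit Types (F : X -> \bar R) (B E : set X) (r p q c L : R).
Local Notation outer := (outer (mu := mu)).
Local Notation avg := (avg (mu := mu)).
Local Notation int_pow := (int_pow (mu := mu)).
Local Notation mean := (mean (mu := mu)).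
Local Notation sharp_avg := (sharp_avg (mu := mu)).
Local Notation tails := (tails (mu := mu)).

Lemma outer_ge0 E : 0 <= outer E.
Proof. by apply: le_ereal_inf_tmp => _ [G [mG _] <-]. Qed.

Lemma outer_le E G : measurable G -> E `<=` G -> outer E <= mu G.
Proof. by move=> mG EG; apply: ereal_inf_lbound; exists G. Qed.

(** Both readings of the integral of a power, the usual one and the layer cake one
    for non-measurable functions, are dominated by the same geometric series. *)
Lemma int_pow_tails r F B c L : (1 <= r)%R -> (0 < L)%R ->
  measurable B -> mu B \is a fin_num -> tails (2 `^ (- (r + 1))) F B c L ->
  int_pow r (fun x => F x - c%:E) B <= ((2 * r * L) `^ r)%:E * mu B.
Proof.
move=> r1 L0 mB Bfin HT; have r0 : (0 < r)%R by exact: lt_le_trans r1.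
have two : (2 * r * L `^ r <= (2 * r * L) `^ r)%R.
  rewrite powRM ?(ltW L0) ?mulr_ge0 ?(ltW r0)// ler_wpM2r ?powR_ge0//.
  by apply: le1r_powR => //; lra.
rewrite /int_pow; case: asboolP => _.
  apply: (le_trans (integral_tails _ L0 mB Bfin HT)); first by rewrite r1 lexx.
  rewrite lee_wpmul2r// lee_fin (le_trans _ two)// ler_wpM2r ?powR_ge0//; lra.
have [E HE] := choice HT.
pose q := (2 `^ (- (r + 1)))%R.
have q0 : (0 <= q)%R by exact: powR_ge0.
have b0 : (0 <= fine (mu B))%R by exact: fine_ge0.
pose a n := ((n.+1%:R * L) `^ (r - 1) * (q ^+ n * fine (mu B)))%R.
have a0 n : (0 <= a n)%R by rewrite !mulr_ge0 ?powR_ge0 ?exprn_ge0.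
(* The layer cake integral is cut into the steps of the tail bound. *)
pose S n : set R := `[(n%:R * L)%R, (n.+1%:R * L)%R[%classic.
have mS n : measurable (S n) by exact: measurable_itv.
have muS n : lebesgue_measure (S n) = L%:E.
  rewrite /= lebesgue_measure_itv/= lte_fin ltr_pM2r// ltr_nat ltnSn.
  by rewrite -EFinB -mulrBl -natrB// subSnn mul1r.
have -> : ((2 * r * L) `^ r)%:E * mu B = r%:E * ((2 * r * L) `^ r / r * fine (mu B))%:E.
  rewrite -[in LHS](fineK Bfin) -!EFinM; congr (_%:E).
  by rewrite [RHS]mulrA [(r * _)%R]mulrC divfK// gt_eqF.
rewrite lee_wpmul2l ?lee_fin ?(ltW r0)//.
apply: (le_trans (@integral_le_steps _ _ _ lebesgue_measure _ _ S a _ mS a0 _ _)).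
- exact: measurable_itv.
- by move=> t _; rewrite mule_ge0 ?lee_fin ?powR_ge0// outer_ge0.
- move=> t; rewrite /= in_itv/= andbT => t0.
  pose n := Num.trunc (t / L).
  have tL0 : (0 <= t / L)%R by rewrite divr_ge0 ?ltW.
  have nt : (n%:R * L <= t)%R by rewrite -ler_pdivlMr// truncn_le.
  have tn : (t < n.+1%:R * L)%R by rewrite -ltr_pdivrMr// truncnS_gt.
  have u0 k : 0 <= (a k)%:E * (\1_(S k) t)%:E by rewrite mule_ge0 ?lee_fin.
  apply: le_trans (@term_le_nneseries _ _ n u0).
  rewrite /= indicE mem_set ?mule1; last by rewrite /S/= in_itv/= nt tn.
  have [mE muE Fle] := HE n.
  rewrite /a EFinM; apply: lee_pmul; rewrite ?lee_fin ?powR_ge0 ?outer_ge0//.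
    rewrite ge0_ler_powR ?nnegrE ?(ltW t0) ?(ltW tn)//; first by lra.
    by rewrite mulr_ge0// ltW.
  rewrite EFinM fineK//; apply: le_trans muE; apply: outer_le => // x [Bx Fx].
  apply: contrapT => nEx; move: Fx; apply/negP; rewrite -leNgt.
  by apply: (le_trans (Fle x Bx nEx)); rewrite lee_fin -mulr_natl.
apply: (@le_trans _ _ (2 * (L `^ r * fine (mu B)))%:E); last first.
  rewrite lee_fin mulrA ler_wpM2r// ler_pdivlMr// mulrAC; exact: two.
apply: nneseries_half_le.
- by rewrite mulr_ge0// powR_ge0.
- by move=> n; rewrite mule_ge0// lee_fin.
- move=> n.
  apply: (@le_trans _ _ ((a n)%:E * L%:E)).
    rewrite lee_wpmul2l ?lee_fin//.
    rewrite -(muS n); apply: le_measure; rewrite ?inE//; last exact: mS.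
    by apply: measurableI; [exact: mS|exact: measurable_itv].
  rewrite -EFinM lee_fin /a powRM ?(ltW L0)//.
  have -> : (L `^ r = L `^ (r - 1) * L)%R.
    rewrite -[X in (_ * X)%R]powRr1 ?(ltW L0)// -powRD ?subrK//.
    by rewrite gt_eqF// implybT.
  have -> : (n.+1%:R `^ (r - 1) * L `^ (r - 1) * (q ^+ n * fine (mu B)) * L =
    (n.+1%:R `^ (r - 1) * q ^+ n) * (L `^ (r - 1) * L * fine (mu B)))%R by ring.
  rewrite [leRHS]mulrC ler_wpM2r ?mulr_ge0 ?powR_ge0 ?(ltW L0)//.
  by apply: polynomial_geometric_le; lra.
Qed.

Lemma avg_le r F B (W : R) : (1 <= r)%R -> (0 <= W)%R -> mu B \is a fin_num ->
  0 < mu B -> int_pow r F B <= (W `^ r)%:E * mu B -> 0 <= int_pow r F B ->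
  avg r F B <= W%:E.
Proof.
move=> r1 W0 Bfin B0 HI I0; have r0 : (0 < r)%R by exact: lt_le_trans r1.
have b0 : (0 < fine (mu B))%R by rewrite fine_gt0// B0 ltey_eq Bfin.
rewrite /avg.
have -> : W%:E = (W `^ r)%:E `^ r^-1.
  by rewrite poweR_EFin -powRrM divff ?powRr1// gt_eqF.
apply: gt0_ler_poweR.
- by rewrite invr_ge0 ltW.
- by rewrite in_itv/= leey andbT mule_ge0// lee_fin invr_ge0 ltW.
- by rewrite in_itv/= leey andbT lee_fin powR_ge0.
- by rewrite lee_pdivrMl// muleC fineK.
Qed.

Lemma int_pow_ge0 r F B : (0 <= r)%R -> 0 <= int_pow r F B.
Proof.
move=> r0; rewrite /int_pow; case: asboolP => _.
  by apply: integral_ge0 => x _; exact: poweR_ge0.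
rewrite mule_ge0 ?lee_fin//; apply: integral_ge0 => t _.
by rewrite mule_ge0 ?lee_fin ?powR_ge0// outer_ge0.
Qed.

Lemma mean_center F B c L : measurable_fun setT F -> (0 < L)%R ->
  measurable B -> mu B \is a fin_num -> 0 < mu B ->
  \int[mu]_(x in B) `|F x - c%:E| <= (2 * L)%:E * mu B ->
  exists2 m : R, mean F B = m%:E & (`|c - m| <= 2 * L)%R.
Proof.
move=> mF L0 mB Bfin B0 HI.
have b0 : (0 < fine (mu B))%R by rewrite fine_gt0// B0 ltey_eq Bfin.
have mFB : measurable_fun B F by exact: measurable_funTS.
have mFc : measurable_fun B (fun x => F x - c%:E) by apply: emeasurable_funB.
have iFc : mu.-integrable B (fun x => F x - c%:E).
  apply/integrableP; split => //; apply: (le_lt_trans HI).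
  by rewrite -(fineK Bfin) -EFinM ltry.
have ic : mu.-integrable B (cst c%:E).
  apply/integrableP; split; first exact: measurable_cst.
  by rewrite (integral_cst mu mB `|c%:E|) -(fineK Bfin) -EFinM ltry.
have IF : \int[mu]_(x in B) F x = \int[mu]_(x in B) (F x - c%:E) + c%:E * mu B.
  rewrite -(integral_cst mu mB c%:E) -integralD//; apply: eq_integral => x _.
  case: (F x) => [y| |]//.
  by transitivity (y - c + c)%R%:E => //; rewrite subrK.
have fFc := integrable_fin_num mB iFc.
have := le_abse_integral mu mB mFc; move=> /le_trans/(_ HI).
rewrite /mean IF; rewrite -(fineK fFc) -(fineK Bfin).
set u := fine (\int[mu]_(x in B) _); set b := fine (mu B).
rewrite -EFinM -EFinD /= -EFinM lee_fin => ub.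
have bn0 : fine b%:E != 0%R by rewrite gt_eqF.
exists (u / b + c)%R.
  by congr (_%:E) => /=; rewrite mulrDr (mulrC c) mulKf//= mulrC.
by rewrite distrC addrK normrM normfV (gtr0_norm b0) ler_pdivrMr.
Qed.

Lemma tails_recenter q F B c m L : (0 <= L)%R -> measurable B -> tails q F B c L ->
  (`|c - m| <= 2 * L)%R -> tails q F B m (3 * L).
Proof.
move=> L0 mB HT cm [|n]; first by exists B; rewrite expr0 mul1e.
have [E [mE muE Fle]] := HT n.+1; exists E; split=> // x Bx nEx.
apply: (le_trans (lee_dist_recenter (Fle x Bx nEx) cm)).
rewrite lee_fin -(mulr_natl L n.+1) -(mulr_natl (3 * L)%R n.+1) (mulrS 1%R n).
have : (0 <= n%:R * L)%R by rewrite mulr_ge0.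
lra.
Qed.

(** For measurable [F] the sharp average is centred at the mean, which the case of
    exponent [1] places within [2 * L] of [c]. *)
Lemma sharp_avg_tails r F B c L : (1 <= r)%R -> (0 < L)%R ->
  measurable B -> mu B \is a fin_num -> 0 < mu B ->
  tails (2 `^ (- (r + 1))) F B c L -> sharp_avg r F B <= (6 * r * L)%:E.
Proof.
move=> r1 L0 mB Bfin B0 HT; have r0 : (0 < r)%R by exact: lt_le_trans r1.
have avgle m L' : (0 < L')%R -> tails (2 `^ (- (r + 1))) F B m L' ->
    avg r (fun x => F x - m%:E) B <= (2 * r * L')%:E.
  move=> L'0 HT'; apply: avg_le => //.
  - by rewrite !mulr_ge0// ltW.
  - exact: int_pow_tails.
  - by apply: int_pow_ge0; exact: ltW.
rewrite /sharp_avg; case: asboolP => [mF|_].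
  have [//|m mE cm] := @mean_center F B c L mF L0 mB Bfin B0.
    have := @integral_tails _ _ _ mu 1%R r F B c L _ L0 mB Bfin HT.
    rewrite lexx r1 powRr1 ?(ltW L0)// => /(_ isT); apply: le_trans.
    by apply: ge0_le_integral_any => // x _; rewrite poweRe1.
  rewrite mE; have -> : (6 * r * L = 2 * r * (3 * L))%R by ring.
  apply: avgle; first by rewrite mulr_gt0.
  by apply: tails_recenter cm => //; exact: ltW.
apply: (@le_trans _ _ (avg r (fun x => F x - c%:E) B)).
  by apply: ereal_inf_lbound; exists c.
apply: (le_trans (avgle _ _ L0 HT)).
have : (0 <= r * L)%R by rewrite mulr_ge0// ltW.
by rewrite lee_fin -!mulrA; lra.
Qed.

End sharp_average.

(** * Averages over a ball and over larger balls *)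

Section averages.
Context {R : realType} {d : measure_display} {X : measurableType d}
        {mu : {measure set X -> \bar R}}.
Variables (BB : ball_basis mu) (r : R).
Hypothesis r1 : (1 <= r)%R.
Local Notation K := (hull_const BB).
Implicit Types (A B : set X) (f g h : X -> R) (s t : R).

Let r0 : (0 < r)%R. Proof. exact: lt_le_trans r1. Qed.

Definition Lr_le g A s :=
  \int[mu]_(x in A) (`|g x| `^ r)%:E <= (s `^ r)%:E * mu A.

Lemma powR_le2 s t : (0 <= s)%R -> (0 <= t)%R ->
  ((s + t) `^ r <= 2 `^ r * (s `^ r + t `^ r))%R.
Proof.
move=> s0 t0; have ph u v : (0 <= u <= v)%R -> (u `^ r <= v `^ r)%R.
  by move=> /andP[u0 uv]; rewrite ge0_ler_powR ?nnegrE ?(ltW r0) ?(le_trans u0 uv).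
have [st|/ltW ts] := leP s t.
- apply: (@le_trans _ _ ((2 * t) `^ r)%R); first by apply: ph; lra.
  by rewrite powRM// ler_wpM2l ?powR_ge0// lerDr powR_ge0.
- apply: (@le_trans _ _ ((2 * s) `^ r)%R); first by apply: ph; lra.
  by rewrite powRM// ler_wpM2l ?powR_ge0// lerDl powR_ge0.
Qed.

Lemma powR_sum_le s t : (0 <= s)%R -> (0 <= t)%R ->
  (2 `^ r * (s `^ r + t `^ r) <= (4 * (s + t)) `^ r)%R.
Proof.
move=> s0 t0; have st0 : (0 <= s + t)%R by rewrite addr_ge0.
have -> : (4 * (s + t) = 2 * (2 * (s + t)))%R by ring.
rewrite powRM// ?mulr_ge0// ler_wpM2l ?powR_ge0// powRM//.
apply: (@le_trans _ _ (2 * (s + t) `^ r)%R); last first.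
  by rewrite ler_wpM2r ?powR_ge0// le1r_powR ?ler1n.
have ph u : (0 <= u <= s + t)%R -> (u `^ r <= (s + t) `^ r)%R.
  by move=> /andP[u0 uv]; rewrite ge0_ler_powR ?nnegrE ?(ltW r0).
have := ph s; have := ph t.
rewrite s0 t0 lerDl lerDr s0 t0 => /(_ isT) ? /(_ isT) ?; lra.
Qed.

Lemma measurable_powR_norm g : measurable_fun setT g ->
  measurable_fun setT (fun x => (`|g x| `^ r)%:E).
Proof.
move=> mg; apply/measurable_EFinP.
apply: (@measurableT_comp _ _ _ _ _ _ (fun y : R => (y `^ r)%R)).
  exact: measurable_powR.
exact: measurableT_comp.
Qed.

(** A quasi-triangle inequality; the factor [4] absorbs the two losses of [2 `^ r]
    incurred by [powR_le2] and [powR_sum_le]. *)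
Lemma Lr_le_add g1 g2 h A (s t : R) : measurable A ->
  measurable_fun setT g1 -> measurable_fun setT g2 -> (0 <= s)%R -> (0 <= t)%R ->
  Lr_le g1 A s -> Lr_le g2 A t ->
  (forall x, A x -> `|h x| <= `|g1 x| + `|g2 x|)%R -> Lr_le h A (4 * (s + t))%R.
Proof.
move=> mA mg1 mg2 s0 t0 H1 H2 Hh.
have mp1 := measurable_funTS (measurable_powR_norm mg1) (D := A).
have mp2 := measurable_funTS (measurable_powR_norm mg2) (D := A).
apply: (@le_trans _ _ (\int[mu]_(x in A)
    ((2 `^ r)%:E * ((`|g1 x| `^ r)%:E + (`|g2 x| `^ r)%:E)))).
  apply: ge0_le_integral_any => x Ax; first by rewrite lee_fin powR_ge0.
  rewrite -EFinD -EFinM lee_fin; apply: le_trans (powR_le2 _ _) => //.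
  by rewrite ge0_ler_powR ?nnegrE ?(ltW r0) ?addr_ge0// Hh.
rewrite ge0_integralZl ?lee_fin ?powR_ge0//; last 2 first.
- exact: emeasurable_funD.
- by move=> x _; rewrite adde_ge0// lee_fin powR_ge0.
have p0 g x : A x -> 0 <= (`|g x| `^ r)%:E by rewrite lee_fin powR_ge0.
rewrite ge0_integralD//.
apply: (@le_trans _ _ ((2 `^ r)%:E * ((s `^ r)%:E * mu A + (t `^ r)%:E * mu A))).
  by rewrite lee_wpmul2l ?lee_fin ?powR_ge0// leeD.
rewrite -ge0_muleDl ?lee_fin ?powR_ge0// muleA -EFinD -EFinM.
by rewrite lee_wpmul2r// lee_fin powR_sum_le.
Qed.

Lemma Lr_le_cst (t : R) A : measurable A -> Lr_le (cst t) A `|t|.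
Proof. by move=> mA; rewrite /Lr_le (integral_cst mu mA (`|t| `^ r)%:E). Qed.

Lemma Lr_le_mono g A s t : (0 <= s <= t)%R -> Lr_le g A s -> Lr_le g A t.
Proof.
move=> /andP[s0 st] /le_trans; apply; rewrite lee_wpmul2r// lee_fin.
by rewrite ge0_ler_powR ?nnegrE ?(ltW r0) ?(le_trans s0 st).
Qed.

Lemma Lr_le_sub g A A' s k : measurable A -> measurable A' ->
  measurable_fun setT g -> A `<=` A' -> (1 <= k)%R -> (0 <= s)%R ->
  mu A' <= k%:E * mu A -> Lr_le g A' s -> Lr_le g A (k * s)%R.
Proof.
move=> mA mA' mg AA' k1 s0 kA HA'.
have mp := measurable_funTS (measurable_powR_norm mg) (D := A').
apply: (@le_trans _ _ (\int[mu]_(x in A') (`|g x| `^ r)%:E)).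
  by apply: ge0_subset_integral => // x _; rewrite lee_fin powR_ge0.
apply: (le_trans HA'); apply: (@le_trans _ _ ((s `^ r)%:E * (k%:E * mu A))).
  by rewrite lee_wpmul2l ?lee_fin ?powR_ge0.
rewrite muleA -EFinM lee_wpmul2r// lee_fin powRM//; last by lra.
by rewrite mulrC ler_wpM2r ?powR_ge0// le1r_powR.
Qed.

Lemma Lr_le_cst_inv (c s : R) A : measurable A -> 0 < mu A -> mu A \is a fin_num ->
  (0 <= s)%R -> Lr_le (cst c) A s -> (`|c| <= s)%R.
Proof.
move=> mA A0 Afin s0; rewrite /Lr_le (integral_cst mu mA (`|c| `^ r)%:E).
rewrite -(fineK Afin) -!EFinM lee_fin ler_pM2r; last by rewrite fine_gt0// A0 ltey_eq Afin.
move=> H; rewrite leNgt; apply/negP => sc; move: H; apply/negP; rewrite -ltNge.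
by rewrite gt0_ltr_powR ?nnegrE.
Qed.

Lemma Lr_le_center f A (c c' s t : R) : measurable A -> measurable_fun setT f ->
  0 < mu A -> mu A \is a fin_num -> (0 <= s)%R -> (0 <= t)%R ->
  Lr_le (fun x => f x - c)%R A s -> Lr_le (fun x => f x - c')%R A t ->
  (`|c - c'| <= 4 * (s + t))%R.
Proof.
move=> mA mf A0 Afin s0 t0 H1 H2.
apply: (Lr_le_cst_inv mA A0 Afin); first by rewrite mulr_ge0// addr_ge0.
apply: (Lr_le_add mA _ _ s0 t0 H1 H2); try exact: measurable_funB.
by move=> x _ /=; rewrite (distrC (f x) c) ler_distD.
Qed.

(** The constant is the mean, which cannot be infinite: the sharp average would be
    infinite too. *)
Lemma bmo_center f s B : measurable_fun setT f -> balls BB B ->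
  bmo_norm BB r (EFin \o f) < s%:E -> exists c, Lr_le (fun x => f x - c)%R B s.
Proof.
move=> mf bB norms.
have mF : measurable_fun setT (EFin \o f) by exact/measurable_EFinP.
have b0 := ball_fine_gt0 bB.
have mB := balls_measurable bB.
have : sharp_avg (mu := mu) r (EFin \o f) B < s%:E.
  by apply: le_lt_trans norms; apply: ereal_sup_ubound; exists B.
rewrite /sharp_avg asboolT//.
have mFm : measurable_fun setT (fun x => (EFin \o f) x - mean (mu := mu) (EFin \o f) B).
  case: (mean _ _) => [m| |]; first exact: emeasurable_funB.
  - by apply: (eq_measurable_fun (cst -oo)).
  - by apply: (eq_measurable_fun (cst +oo)).
rewrite /avg /int_pow asboolT//.
case: (mean _ _) => [m| |] H; last 2 first.
- have rn0 : r != 0%R by rewrite gt_eqF.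
  have rn0' : (r^-1 != 0)%R by rewrite invr_eq0.
  exfalso; move: H; rewrite (integral_cst mu mB (+oo `^ r)) poweRyr//.
  rewrite gt0_mulye ?(balls_measure_gt0 bB)// gt0_muley ?lte_fin ?invr_gt0//.
  by rewrite poweRyr.
- have rn0 : r != 0%R by rewrite gt_eqF.
  have rn0' : (r^-1 != 0)%R by rewrite invr_eq0.
  exfalso; move: H; rewrite (integral_cst mu mB (+oo `^ r)) poweRyr//.
  rewrite gt0_mulye ?(balls_measure_gt0 bB)// gt0_muley ?lte_fin ?invr_gt0//.
  by rewrite poweRyr.
exists m; rewrite /Lr_le; rewrite leNgt; apply/negP => lt_int.
move: H; apply/negP; rewrite -leNgt.
have s0 : (0 <= s)%R.
  have : sharp_avg (mu := mu) r (EFin \o f) B < s%:E.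
    by apply: le_lt_trans norms; apply: ereal_sup_ubound; exists B.
  rewrite /sharp_avg asboolT// => /(le_lt_trans (poweR_ge0 _ _)).
  by rewrite lte_fin => /ltW.
have -> : s%:E = (s `^ r)%:E `^ r^-1.
  by rewrite poweR_EFin -powRrM divff ?powRr1// gt_eqF.
apply: gt0_ler_poweR.
- by rewrite invr_ge0 ltW.
- by rewrite in_itv/= leey andbT lee_fin powR_ge0.
- rewrite in_itv/= leey andbT mule_ge0// ?lee_fin ?invr_ge0 ?(ltW b0)//.
  by apply: integral_ge0 => x _; rewrite lee_fin powR_ge0.
- rewrite lee_pdivlMl// muleC -(ball_fine bB); apply: (le_trans (ltW lt_int)).
  by apply: ge0_le_integral_any => x _; rewrite lee_fin ?powR_ge0.
Qed.

End averages.

Section growth.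
Context {R : realType} {d : measure_display} {X : measurableType d}
        {mu : {measure set X -> \bar R}}.
Variables (BB : ball_basis mu) (r eta : R).
Hypotheses (r1 : (1 <= r)%R) (eta2 : (2 < eta)%R) (dbl : doubling_at BB eta).
Local Notation K := (hull_const BB).
Local Notation Lr_le := (Lr_le (mu := mu) r).
Implicit Types (A B : set X).
Variables (f : X -> R) (s : R) (c : set X -> R).
Hypotheses (mf : measurable_fun setT f) (s0 : (0 <= s)%R).
Hypothesis cP : forall B, balls BB B -> Lr_le (fun x => f x - c B)%R B s.

Let mfc (a : R) : measurable_fun setT (fun x => f x - a)%R.
Proof. exact: measurable_funB. Qed.

Lemma ball_fin_num B : balls BB B -> mu B \is a fin_num.
Proof. by move=> bB; rewrite (ball_fine bB). Qed.

Lemma center_nested B B' k : balls BB B -> balls BB B' -> B `<=` B' ->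
  (1 <= k)%R -> mu B' <= k%:E * mu B -> (`|c B - c B'| <= 4 * (k + 1) * s)%R.
Proof.
move=> bB bB' BB' k1 kB; have mB := balls_measurable bB.
have H : Lr_le (fun x => f x - c B')%R B (k * s)%R.
  by apply: (Lr_le_sub r1) (cP bB') => //; exact: balls_measurable bB'.
have := Lr_le_center r1 mB mf (balls_measure_gt0 bB) (ball_fin_num bB) s0 _ (cP bB) H.
have ks0 : (0 <= k * s)%R by rewrite mulr_ge0//; lra.
by move=> /(_ ks0) /le_trans; apply; rewrite le_eqVlt; apply/orP; left; apply/eqP; ring.
Qed.

Lemma growth_in_hull A B : balls BB A -> balls BB B -> A `<=` hull BB B ->
  mu B <= eta%:E * mu A ->
  exists2 c', Lr_le (fun x => f x - c')%R A (K * eta * s)%R &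
              (`|c B - c'| <= 4 * (K + eta + 1) * s)%R.
Proof.
move=> bA bB AhB BA; have K1 := hull_const_ge1 bB.
have e2 := eta2; have e1 : (1 <= eta)%R by lra.
have bhB := hull_balls bB; exists (c (hull BB B)).
  apply: (Lr_le_sub r1) (cP bhB) => //.
  - exact: balls_measurable bA.
  - exact: balls_measurable bhB.
  - by rewrite mulr_ege1.
  - apply: (le_trans (hull_measure bB)); rewrite EFinM -muleA.
    by rewrite lee_wpmul2l// lee_fin; lra.
apply: (le_trans (center_nested bB bhB (sub_hull_self bB) K1 (hull_measure bB))).
by rewrite ler_wpM2r// ler_wpM2l//; lra.
Qed.

(** Climb from [B] by doubling until [A] fits into the hull; each of the at most
    [n + 1] steps moves the constant by [O(s)]. *)
Lemma growth n A B : balls BB A -> balls BB B -> A `&` B !=set0 ->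
  mu B <= eta%:E * mu A -> mu A <= (2 ^+ n.+1)%:E * mu B ->
  exists2 c', Lr_le (fun x => f x - c')%R A (K * eta * s)%R &
              (`|c B - c'| <= 4 * (K + eta + 1) * s *+ n.+1)%R.
Proof.
have e2 := eta2; have e1 : (1 <= eta)%R by lra.
elim: n B => [|n IHn] B bA bB AB BA le_n.
all: have K1 := hull_const_ge1 bB.
all: have Ks0 : (0 <= 4 * (K + eta + 1) * s)%R by (rewrite !mulr_ge0//; lra).
- rewrite mulr1n; apply: growth_in_hull => //; exact: sub_hull.
- have [le2|] := leP (mu A) (2%:E * mu B).
    have [|c' H1 H2] := growth_in_hull bA bB _ BA; first exact: sub_hull.
    exists c' => //; apply: (le_trans H2);
      by rewrite [leRHS]mulrSr lerDr mulrn_wge0.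
  move=> lt2; have [hT|/(dbl bB)[B' [bB' BB' le1 le3]]] := pselect (hull BB B = setT).
    have [|c' H1 H2] := growth_in_hull bA bB _ BA; first by rewrite hT.
    exists c' => //; apply: (le_trans H2);
      by rewrite [leRHS]mulrSr lerDr mulrn_wge0.
  have [|||c' H1 H2] := IHn B' bA bB'.
  + by case: AB => x [Ax Bx]; exists x; split=> //; exact: BB'.
  + have leBA : mu B <= mu A.
      apply: le_trans (ltW lt2); rewrite (ball_fine bB) -EFinM lee_fin.
      by have := ball_fine_gt0 bB; lra.
    apply: (le_trans le3); rewrite lee_wpmul2l// lee_fin; lra.
  + apply: (le_trans le_n); rewrite exprSr EFinM -muleA lee_wpmul2l// lee_fin exprn_ge0.
  exists c' => //; rewrite [leRHS]mulrSr; apply: (le_trans (ler_distD (c B') _ _)).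
  rewrite [leRHS]addrC; apply: lerD => //.
  apply: (le_trans (center_nested bB bB' BB' e1 le3)); by rewrite ler_wpM2r// ler_wpM2l//; lra.
Qed.

Definition log2 (t : R) : R := (ln t / ln 2)%R.

Lemma log2_1D_ge1 (t : R) : (1 <= t)%R -> (1 <= log2 (1 + t))%R.
Proof.
move=> t1; have ln2 : (0 < ln 2 :> R)%R by rewrite ln_gt0// ltr1n.
by rewrite /log2 ler_pdivlMr// mul1r ler_ln ?posrE//; lra.
Qed.

(** The cancellation behind the whole estimate: the weight of the oscillation bound is
    the reciprocal of the growth of mean oscillations in [growth_log]. *)
Lemma omega_log2 (t : R) : (1 <= t)%R -> (omega_log t * log2 (1 + t) = 1)%R.
Proof.
move=> t1; rewrite /omega_log -/(log2 (1 + t)) mulVf// gt_eqF//.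
by rewrite (lt_le_trans _ (log2_1D_ge1 t1)).
Qed.

Lemma dyadic_log2 (t : R) : (1 <= t)%R ->
  exists2 n : nat, (t <= 2 ^+ n.+1)%R & (n.+1%:R <= 2 * log2 (1 + t))%R.
Proof.
move=> t1; have ln2 : (0 < ln 2 :> R)%R by rewrite ln_gt0// ltr1n.
have lt0 : (0 <= log2 t)%R by rewrite /log2 divr_ge0 ?ln_ge0 ?ler1n.
exists (Num.trunc (log2 t)).
  rewrite -ler_ln ?posrE ?exprn_gt0//; last by lra.
  rewrite lnXn// -[leRHS]mulr_natl -ler_pdivrMr// ltW//; exact: truncnS_gt.
have : ((Num.trunc (log2 t))%:R <= log2 t)%R by rewrite truncn_le.
have : (log2 t <= log2 (1 + t))%R.
  by rewrite /log2 ler_pM2r ?invr_gt0// ler_ln ?posrE//; lra.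
have := log2_1D_ge1 t1.
rewrite (mulrS 1%R); lra.
Qed.

Lemma growth_log A B : balls BB A -> balls BB B -> B `<=` A ->
  Lr_le (fun x => f x - c B)%R A
    (4 * (K * eta + 8 * (K + eta + 1)) * s * log2 (1 + fine (mu A) / fine (mu B)))%R.
Proof.
move=> bA bB BA; have e2 := eta2; have K1 := hull_const_ge1 bB.
have b0 := ball_fine_gt0 bB.
have mA := balls_measurable bA.
set t := (fine (mu A) / fine (mu B))%R.
have muBA : mu B <= mu A.
  by apply: le_measure; rewrite ?inE//; exact: balls_measurable bB.
have t1 : (1 <= t)%R.
  by rewrite /t ler_pdivlMr// mul1r -lee_fin -(ball_fine bA) -(ball_fine bB).
have [n tn nl] := dyadic_log2 t1.
have l1 := log2_1D_ge1 t1.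
have [|||c' H1 H2] := @growth n A B bA bB.
- by have [x Bx] := ball_nonempty bB; exists x; split=> //; exact: BA.
- apply: (le_trans muBA); rewrite (ball_fine bA) -EFinM lee_fin.
  by rewrite ler_peMl ?fine_ge0//; lra.
- by rewrite (ball_fine bA) (ball_fine bB) -EFinM lee_fin -ler_pdivrMr.
have Kes0 : (0 <= K * eta * s)%R by rewrite !mulr_ge0//; lra.
have := Lr_le_add r1 mA (mfc c') (measurable_cst (c B - c')%R) Kes0
  (normr_ge0 (c B - c')%R) H1 (Lr_le_cst (mu := mu) r (c B - c')%R mA).
move=> /(_ (fun x => f x - c B)%R); move=> H.
apply: Lr_le_mono (H _) => //; last first.
  by move=> x _; rewrite /= (distrC (c B)) ler_distD.
rewrite mulr_ge0 ?addr_ge0//=.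
have Ks0 : (0 <= (K + eta + 1) * s)%R by rewrite mulr_ge0//; lra.
have l0 : (0 <= log2 (1 + t))%R by lra.
have -> : (4 * (K * eta + 8 * (K + eta + 1)) * s * log2 (1 + t) =
  4 * (K * eta * s * log2 (1 + t) + 4 * ((K + eta + 1) * s * (2 * log2 (1 + t)))))%R by ring.
rewrite ler_wpM2l// lerD//; first by rewrite ler_peMr.
apply: (le_trans H2); rewrite -[leLHS]mulr_natl -!mulrA.
rewrite mulrCA ler_wpM2l// [leRHS]mulrA [leRHS]mulrC ler_wpM2r//.
Qed.

End growth.

(** * Weak type bounds for extremal operators *)

Section maximal_operators.
Context {R : realType} {d : measure_display} {X : measurableType d}
        {mu : {measure set X -> \bar R}}.
Variable r : R.
Hypothesis r1 : (1 <= r)%R.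
Local Notation operator := (@operator R d X).
Local Notation outer := (outer (mu := mu)).
Implicit Types (A B E : set X) (f g h : X -> R).

Let r0 : (0 < r)%R. Proof. exact: lt_le_trans r1. Qed.

Let r1e : 1 <= r%:E. Proof. by rewrite lee_fin. Qed.

Lemma Lfun_measurable f : f \in Lfun mu r%:E -> measurable_fun setT f.
Proof. by move=> /andP[]; rewrite inE. Qed.

Lemma Lnorm_EFinE f : 'N[mu]_r%:E[EFin \o f] = (\int[mu]_x (`|f x| `^ r)%:E) `^ r^-1.
Proof. by rewrite unlock. Qed.

Lemma Lfun_lin (a : R) f g : f \in Lfun mu r%:E -> g \in Lfun mu r%:E ->
  (fun y => a * f y + g y)%R \in Lfun mu r%:E.
Proof. by move=> fL gL; have [_] := Lfun_submod_closed mu r1e; exact. Qed.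

Lemma Lfun_dominated f g : measurable_fun setT g -> f \in Lfun mu r%:E ->
  (forall x, `|g x| <= `|f x|)%R -> g \in Lfun mu r%:E.
Proof.
move=> mg fL gf; apply/andP; split; first by rewrite inE.
rewrite inE/= /finite_norm; move: fL => /andP[_]; rewrite inE/= /finite_norm.
rewrite !Lnorm_EFinE; apply: le_lt_trans; apply: gt0_ler_poweR.
- by rewrite invr_ge0 ltW.
- by rewrite in_itv/= leey andbT; apply: integral_ge0 => x _; rewrite lee_fin powR_ge0.
- by rewrite in_itv/= leey andbT; apply: integral_ge0 => x _; rewrite lee_fin powR_ge0.
- apply: ge0_le_integral_any => x _; first by rewrite lee_fin powR_ge0.
  by rewrite lee_fin ge0_ler_powR ?nnegrE ?(ltW r0).
Qed.

Lemma Lfun_indic B : measurable B -> mu B < +oo -> \1_B \in Lfun mu r%:E.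
Proof.
move=> mB Bfin; apply/andP; split; first by rewrite inE/=; exact: measurable_indic.
rewrite inE/= /finite_norm Lnorm_EFinE.
have -> : \int[mu]_x (`|\1_B x| `^ r)%:E = mu B.
  have := integral_indic mu measurableT mB; rewrite setIT => <-; apply: eq_integral => x _.
  by rewrite indicE; case: (_ \in _); rewrite ?normr1 ?powR1// normr0 powR0// gt_eqF.
by rewrite -(@fineK _ (mu B)) ?ge0_fin_numE// poweR_EFin ltry.
Qed.

Lemma Lfun_restrict f A : measurable A -> f \in Lfun mu r%:E ->
  (fun x => f x * \1_A x)%R \in Lfun mu r%:E.
Proof.
move=> mA fL; apply: (Lfun_dominated _ fL).
  by apply: measurable_funM; [exact: Lfun_measurable|exact: measurable_indic].
by move=> x; rewrite normrM indicE; case: (_ \in _); rewrite ?normr1 ?mulr1// normr0 mulr0.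
Qed.

Lemma weak_type_tail (T : operator) (M V t : R) h : (0 < M)%R -> (0 < V)%R -> (0 < t)%R ->
  opnorm (mu := mu) r T <= M%:E -> h \in Lfun mu r%:E ->
  'N[mu]_r%:E[EFin \o h] != 0 -> 'N[mu]_r%:E[EFin \o h] <= V%:E ->
  outer [set x | t%:E < `|T h x|] <= ((M * V / t) `^ r)%:E.
Proof.
move=> M0 V0 t0 TM hL hn0 hV; set N := 'N[mu]_r%:E[EFin \o h] in hn0 hV.
have Nfin : N \is a fin_num by rewrite ge0_fin_numE ?Lnorm_ge0// (le_lt_trans hV)// ltry.
have n0 : (0 < fine N)%R.
  by rewrite fine_gt0// lt_neqAle eq_sym hn0 Lnorm_ge0/= ltey_eq Nfin.
have weak : weak_norm (mu := mu) r (T h) <= (M * V)%:E.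
  apply: (@le_trans _ _ (M%:E * N)); last first.
    by rewrite EFinM lee_wpmul2l// lee_fin ltW.
  rewrite -[N](fineK Nfin) -lee_pdivrMr//; apply: le_trans TM.
  by apply: ereal_sup_ubound; exists h.
set E := [set x | _].
have oE0 := outer_ge0 (mu := mu) E.
have : t%:E * outer E `^ r^-1 <= (M * V)%:E.
  by apply: le_trans weak; apply: ereal_sup_ubound; exists t.
rewrite muleC -lee_pdivlMr// -EFinM => H.
have -> : outer E = (outer E `^ r^-1) `^ r.
  by rewrite -poweRrM mulVf ?poweRe1// gt_eqF.
rewrite -poweR_EFin; apply: gt0_ler_poweR => //.
- exact: ltW.
- by rewrite in_itv/= leey andbT poweR_ge0.
- by rewrite in_itv/= leey andbT lee_fin divr_ge0 ?mulr_ge0 ?ltW.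
Qed.

Lemma outer_lt_cover E (a : \bar R) : outer E < a ->
  exists W, [/\ measurable W, E `<=` W & mu W < a].
Proof. by move=> /ereal_inf_lt[_ [W [mW EW] <-] Wa]; exists W. Qed.

End maximal_operators.

Section extremal_functionals.
Context {R : realType} {I : Type}.
Implicit Types (p q : I -> \bar R) (Phi : (I -> \bar R) -> \bar R) (t : R).

Definition extremal Phi :=
  [\/ Phi = (fun p => ereal_sup [set p i | i in setT]),
      Phi = (fun p => ereal_inf [set p i | i in setT]) |
      Phi = (fun p => ereal_sup [set `|p i| | i in setT])].

Lemma lee_of_dist (x y : \bar R) t : x \is a fin_num -> y \is a fin_num ->
  `|x - y| <= t%:E -> x <= y + t%:E.
Proof.
case: x => [x| |]//; case: y => [y| |]// _ _; rewrite lee_fin => H.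
by rewrite -EFinD lee_fin; move: H; rewrite ler_norml => /andP[]; lra.
Qed.

Lemma dist_of_lee (x y : \bar R) t : y \is a fin_num ->
  x <= y + t%:E -> y <= x + t%:E -> `|x - y| <= t%:E.
Proof.
case: y => [y| |]// _; case: x => [x| |]//.
by rewrite -!EFinD !lee_fin => *; rewrite ler_norml; apply/andP; split; lra.
Qed.

Lemma extremal_le Phi p q t : extremal Phi ->
  (forall i, p i \is a fin_num) -> (forall i, q i \is a fin_num) ->
  (forall i, `|p i - q i| <= t%:E) -> Phi p <= Phi q + t%:E.
Proof.
move=> HPhi pfin qfin pq.
have ple i : p i <= q i + t%:E by exact: lee_of_dist.
case: HPhi => ->.
- apply: ge_ereal_sup => _ [i _ <-]; apply: (le_trans (ple i)).
  by rewrite leeD2r//; apply: ereal_sup_ubound; exists i.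
- rewrite -leeBlDr//; apply: le_ereal_inf_tmp => _ [i _ <-].
  rewrite leeBlDr//; apply: le_trans (ple i).
  by apply: ereal_inf_lbound; exists i.
- apply: ge_ereal_sup => _ [i _ <-].
  apply: (@le_trans _ _ (`|q i| + t%:E)); last first.
    by rewrite leeD2r//; apply: ereal_sup_ubound; exists i.
  move: (pfin i) (qfin i) (pq i); case: (p i) => [x| |]//; case: (q i) => [y| |]// _ _.
  rewrite -EFinB !abse_EFin -EFinD !lee_fin => /(lerD (lexx `|y|%R)); apply: le_trans.
  by rewrite -{1}(subrKC y x) ler_normD.
Qed.

Lemma extremal_close Phi p q t : extremal Phi ->
  (forall i, p i \is a fin_num) -> (forall i, q i \is a fin_num) ->
  (forall i, `|p i - q i| <= t%:E) -> Phi q \is a fin_num ->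
  `|Phi p - Phi q| <= t%:E.
Proof.
move=> HPhi pfin qfin pq qf; apply: dist_of_lee => //; apply: extremal_le => // i.
rewrite -abseN oppeB; last by rewrite fin_num_adde_defr.
by rewrite addeC.
Qed.

Lemma lee_absP (y : \bar R) t : `|y| <= t%:E <-> (- t)%:E <= y /\ y <= t%:E.
Proof.
case: y => [y| |]; split=> //; rewrite ?lee_fin.
- by rewrite ler_norml => /andP[].
- by move=> /andP; rewrite -ler_norml.
- by move=> [].
- by move=> [].
Qed.

Lemma extremal_bounded Phi p t (i0 : I) : extremal Phi ->
  (forall i, `|p i| <= t%:E) -> `|Phi p| <= t%:E.
Proof.
move=> HPhi pt.
have lb i : (- t)%:E <= p i by have /lee_absP[] := pt i.
have ub i : p i <= t%:E by have /lee_absP[] := pt i.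
case: HPhi => ->; apply/lee_absP; split.
- by apply: le_trans (lb i0) _; apply: ereal_sup_ubound; exists i0.
- by apply: ge_ereal_sup => _ [i _ <-].
- by apply: le_ereal_inf_tmp => _ [i _ <-].
- by apply: le_trans (ub i0); apply: ereal_inf_lbound; exists i0.
- apply: le_trans (lb i0) _; apply: (le_trans (lee_abs _)).
  by apply: ereal_sup_ubound; exists i0.
- by apply: ge_ereal_sup => _ [i _ <-].
Qed.

(** For a supremum, the upper bound at [- h] serves as the lower bound at [h]. *)
Lemma extremal_large Phi p q t i : extremal Phi -> (forall i, q i = - p i) ->
  t%:E < `|p i| -> t%:E < `|Phi p| \/ t%:E < `|Phi q|.
Proof.
move=> HPhi qp; have [p0|p0] := leP 0 (p i).
  rewrite gee0_abs// => tp; case: HPhi => ->.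
  - left; apply: (lt_le_trans tp); apply: le_trans (lee_abs _).
    by apply: ereal_sup_ubound; exists i.
  - right; apply: (lt_le_trans tp); rewrite -abseN; apply: le_trans (lee_abs _).
    by rewrite leeNr -qp; apply: ereal_inf_lbound; exists i.
  - left; apply: (lt_le_trans tp); rewrite -(gee0_abs p0); apply: le_trans (lee_abs _).
    by apply: ereal_sup_ubound; exists i.
rewrite lte0_abs// => tp; case: HPhi => ->.
- right; apply: (lt_le_trans tp); apply: le_trans (lee_abs _); rewrite -qp.
  by apply: ereal_sup_ubound; exists i.
- left; apply: (lt_le_trans tp); rewrite -abseN; apply: le_trans (lee_abs _).
  by rewrite leeN2; apply: ereal_inf_lbound; exists i.
- left; apply: (lt_le_trans tp); rewrite -(lte0_abs p0); apply: le_trans (lee_abs _).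
  by apply: ereal_sup_ubound; exists i.
Qed.

End extremal_functionals.

Section families.
Context {R : realType} {d : measure_display} {X : measurableType d}
        {mu : {measure set X -> \bar R}}.
Variables (BB : ball_basis mu) (r : R).
Hypothesis r1 : (1 <= r)%R.
Local Notation operator := (@operator R d X).
Local Notation outer := (outer (mu := mu)).
Implicit Types (B : set X) (h : X -> R).
Variables (I : Type) (T_ : I -> operator) (Phi : (I -> \bar R) -> \bar R).
Hypothesis HPhi : extremal Phi.
Let T : operator := fun f x => Phi (fun i => T_ i f x).
Variables (M : R).
Hypothesis M0 : (0 < M)%R.
Hypothesis TM : opnorm (mu := mu) r T <= M%:E.
Hypothesis HL0 : forall i, Lr_L0 (mu := mu) r (T_ i).
Hypothesis HCN : common_null_sets BB T_ r.

Lemma ball_escape B (W N : set X) : balls BB B -> measurable W -> mu W < mu B ->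
  mu.-negligible N -> exists x, [/\ B x, ~ W x & ~ N x].
Proof.
move=> bB mW WB [N' [mN' N'0 NN']]; apply: contrapT => /forallNP nox.
have : mu B <= mu (W `|` N').
  apply: le_measure; rewrite ?inE; [exact: balls_measurable bB|exact: measurableU|].
  move=> x Bx; have [Wx|nWx] := pselect (W x); first by left.
  right; apply: NN'; apply: contrapT => nNx; exact: (nox x).
move=> /le_trans/(_ (measureU2 _ mW mN')).
rewrite [X in _ + X](_ : _ = 0) ?adde0; last exact: N'0.
by rewrite leNgt WB.
Qed.

(** For [h] of norm zero the weak type bound says nothing about [T h]; that all
    [T_ i h] vanish outside one null set comes from their oscillation. *)
Lemma family_zero h B : h \in Lfun mu r%:E -> 'N[mu]_r%:E[EFin \o h] = 0 ->
  balls BB B -> exists2 N : set X, mu.-negligible N &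
    forall x, B x -> ~ N x -> forall i, T_ i h x = 0.
Proof.
move=> hL h0 bB; have [Hfin Hlin Hosc] := HCN.
have mh := Lfun_measurable hL.
have h_ae0 : \forall x \ae mu, h x = 0%R.
  have r0 : 0 < r%:E by rewrite lte_fin (lt_le_trans _ r1).
  have mh' : measurable_fun setT (EFin \o h) by exact/measurable_EFinP.
  have := Lnorm_eq0_eq0 mh' r0 h0.
  by apply: filterS => x /(_ Logic.I) /= [].
have h'L := Lfun_lin r1 (-1) hL hL.
have hz i : \forall x \ae mu, T_ i h x = 0.
  have [_ /(_ h _ hL h'L) HT] := HL0 i.
  have hh' : \forall x \ae mu, h x = (-1 * h x + h x)%R.
    by apply: filterS h_ae0 => x ->; rewrite mulr0 addr0.
  have := HT hh'; have := Hlin (-1)%R h h hL hL; have := Hfin h hL.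
  apply: filterS3 => x /(_ i) fx /(_ i) -> ->.
  by rewrite mulN1e addeC subee.
have [N negN HN] := Hosc h B hL bB.
exists N => // x Bx nNx i.
have osc0 : osc (mu := mu) B (T_ i h) <= 0.
  apply: ereal_inf_lbound; exists (~` [set x | T_ i h x = 0]); first exact: hz.
  move=> y z [_ /contrapT/= ->] [_ /contrapT/= ->].
  by rewrite sube0 abse0.
have [y [By _ nNy]] : exists y, [/\ B y, ~ set0 y & ~ (N `|` ~` [set x | T_ i h x = 0]) y].
  apply: (ball_escape bB measurable0).
    by rewrite measure0 (balls_measure_gt0 bB).
  by apply: negligibleU => //; exact: hz.
move/not_orP : nNy => [nNy /contrapT/= Ty].
have := HN i x y (conj Bx nNx) (conj By nNy).
move=> /le_trans/(_ osc0); rewrite Ty sube0 => H.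
by apply/eqP; rewrite -abse_eq0 eq_le H abse_ge0.
Qed.

(** The negative of [h] is written as [-2 * h + h], which the linearity of the family
    reaches from [h] alone. *)
Lemma Lnorm_neg h : 'N[mu]_r%:E[EFin \o (fun y => -2 * h y + h y)%R] =
  'N[mu]_r%:E[EFin \o h].
Proof.
rewrite !Lnorm_EFinE; congr (_ `^ _); apply: eq_integral => x _.
have -> : (-2 * h x + h x = - h x)%R by ring.
by rewrite normrN.
Qed.

(** The weak type bound of the extremal operator at [h] and at [- h] controls all
    [T_ i h] at once. *)
Lemma family_tail h (V t a : R) B : h \in Lfun mu r%:E -> (0 < V)%R -> (0 < t)%R ->
  'N[mu]_r%:E[EFin \o h] <= V%:E -> ((M * V / t) `^ r < a)%R -> balls BB B ->
  exists W, [/\ measurable W, mu W <= (a + a)%:E &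
    forall x, B x -> ~ W x -> forall i, `|T_ i h x| <= t%:E].
Proof.
move=> hL V0 t0 hV Va bB.
have a0 : (0 < a)%R by apply: le_lt_trans Va; exact: powR_ge0.
have [hN0|hN0] := eqVneq ('N[mu]_r%:E[EFin \o h]) 0.
  have [N [W [mW W0 NW]] HN] := family_zero hL hN0 bB.
  exists W; split=> //; first by rewrite [X in X <= _](_ : _ = 0) ?lee_fin ?addr_ge0 ?ltW.
  by move=> x Bx nWx i; rewrite HN// ?abse0 ?lee_fin ?ltW// => /NW.
have h'L := Lfun_lin r1 (-2) hL hL.
have tail k : k \in Lfun mu r%:E -> 'N[mu]_r%:E[EFin \o k] = 'N[mu]_r%:E[EFin \o h] ->
    exists W, [/\ measurable W, [set x | t%:E < `|T k x|] `<=` W & mu W < a%:E].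
  move=> kL kN; apply: outer_lt_cover.
  have := @weak_type_tail _ _ _ mu r r1 T M V t k M0 V0 t0 TM kL.
  by rewrite kN => /(_ hN0 hV) /le_lt_trans; apply; rewrite lte_fin.
have [W1 [mW1 sW1 W1a]] := tail _ hL erefl.
have [W2 [mW2 sW2 W2a]] := tail _ h'L (Lnorm_neg h).
have [Hfin Hlin _] := HCN.
have : \forall x \ae mu, forall i, T_ i (fun y => -2 * h y + h y)%R x = - T_ i h x.
  have := Hlin (-2)%R h h hL hL; have := Hfin h hL.
  apply: filterS2 => x Hx Hl i; rewrite Hl; move: (Hx i).
  case: (T_ i h x) => [y| |]// _; rewrite -EFinM -EFinD; congr (_%:E); ring.
move=> [N [mN N0 NN]].
exists ((W1 `|` W2) `|` N); split.
- by apply: measurableU => //; exact: measurableU.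
- apply: (le_trans (measureU2 _ _ mN)); first exact: measurableU.
  rewrite [X in _ + X](_ : _ = 0) ?adde0; last exact: N0.
  apply: (le_trans (measureU2 _ mW1 mW2)).
  by rewrite EFinD; apply: leeD; exact: ltW.
- move=> x Bx /not_orP[/not_orP[nW1 nW2] nN] i.
  have neg : forall i, T_ i (fun y => -2 * h y + h y)%R x = - T_ i h x.
    by apply: contrapT => nH; apply: nN; exact: NN.
  rewrite leNgt; apply/negP => lt_t.
  by have [/sW1|/sW2] := extremal_large HPhi neg lt_t.
Qed.

(** With no index [T] would be constantly infinite, against the weak type bound. *)
Lemma family_inhabited B : balls BB B -> inhabited I.
Proof.
move=> bB; apply: contrapT => nI.
have noI (i : I) : False by exact: nI (inhabits i).
have mB := balls_measurable bB.
have b0 := ball_fine_gt0 bB.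
have BL : \1_B \in Lfun mu r%:E.
  exact: (Lfun_indic r1 mB (balls_measure_lty bB)).
have NB : 'N[mu]_r%:E[EFin \o (\1_B : X -> R)] = ((fine (mu B)) `^ r^-1)%:E.
  rewrite Lnorm_EFinE -poweR_EFin -(ball_fine bB); congr (_ `^ _).
  have := integral_indic mu measurableT mB; rewrite setIT => <-; apply: eq_integral => x _.
  rewrite indicE; case: (_ \in _); rewrite ?normr1 ?powR1// normr0 powR0// gt_eqF//.
  exact: lt_le_trans r1.
pose V := (fine (mu B) `^ r^-1)%R.
have V0 : (0 < V)%R by exact: powR_gt0.
(* [a <= 1] makes [a `^ r <= a]. *)
pose a := Num.min 1%R (fine (mu B) / 2)%R.
have a0 : (0 < a)%R by rewrite lt_min ltr01 divr_gt0.
have := @weak_type_tail _ _ _ mu r r1 T M V (M * V / a)%R _ M0 V0 _ TM BL.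
rewrite NB => /(_ _ _ (lexx _)) H.
have : outer [set x | (M * V / a)%:E < `|T \1_B x|] < mu B.
  apply: (le_lt_trans (H _ _)).
  - by rewrite divr_gt0// mulr_gt0.
  - by rewrite gt_eqF// lte_fin.
  - have -> : (M * V / (M * V / a) = a)%R.
      by rewrite invfM invrK mulrA divff ?mul1r// gt_eqF// mulr_gt0.
    rewrite (ball_fine bB) lte_fin; apply: (@le_lt_trans _ _ a).
      by rewrite ge1r_powR// a0 ge_min lexx.
    apply: (@le_lt_trans _ _ (fine (mu B) / 2)%R); first by rewrite ge_min lexx orbT.
    by rewrite gtr_pMr ?invf_lt1 ?ltr1n.
move=> /outer_lt_cover[W [mW EW WB]].
have [x [Bx nWx _]] := ball_escape bB mW WB (negligible_set0 mu).
apply: nWx; apply: EW => /=; rewrite [ltRHS](_ : _ = +oo) ?ltry// /T.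
have set0E (F : I -> \bar R) : [set F i | i in setT] = set0.
  by apply/seteqP; split=> // y [i]; have := noI i.
by case: HPhi => ->; rewrite set0E ?ereal_sup0 ?ereal_inf0.
Qed.

End families.

(** * Exhausting balls and the oscillation bound *)

Section exhaustion.
Context {R : realType} {d : measure_display} {X : measurableType d}
        {mu : {measure set X -> \bar R}}.
Variables (BB : ball_basis mu) (eta : R).
Hypotheses (eta2 : (2 < eta)%R) (dbl : doubling_at BB eta).
Implicit Types (A B G : set X).

Lemma common_ball B B' : balls BB B -> balls BB B' -> B `&` B' !=set0 ->
  exists G, [/\ balls BB G, B `<=` G & B' `<=` G].
Proof.
move=> bB bB' BB'; have b0 := ball_fine_gt0 bB; have b'0 := ball_fine_gt0 bB'.
have [le|/ltW le] := leP (mu B) (mu B').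
- exists (hull BB B'); split; [exact: hull_balls| |exact: sub_hull_self].
  apply: sub_hull => //; apply: (le_trans le).
  by rewrite (ball_fine bB') -EFinM lee_fin; lra.
- exists (hull BB B); split; [exact: hull_balls|exact: sub_hull_self|].
  apply: sub_hull => //; last by rewrite setIC.
  by apply: (le_trans le); rewrite (ball_fine bB) -EFinM lee_fin; lra.
Qed.

Lemma doubling_chain m G0 : balls BB G0 -> exists G, [/\ balls BB G, G0 `<=` G &
  hull BB G = setT \/ (2 ^+ m)%:E * mu G0 <= mu G].
Proof.
move=> bG0; elim: m => [|m [G [bG G0G HG]]].
  by exists G0; split=> //; right; rewrite expr0 mul1e.
have [hT|hT] := pselect (hull BB G = setT); first by exists G; split=> //; left.
case: HG => // HG.
have [G' [bG' GG' le _]] := dbl bG hT.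
exists G'; split=> //; first exact: subset_trans GG'.
right; apply: le_trans le; rewrite exprS EFinM -muleA lee_wpmul2l//.
Qed.

(** Either doubling goes on, and a ball around [B] which leaves the hull of a late
    member of the chain is huge, or it stops at a ball whose hull is the whole
    space. *)
Lemma exhausting_ball m B G0 : balls BB B -> balls BB G0 -> B `<=` G0 ->
  exists G, [/\ balls BB G, G0 `<=` G & forall A, balls BB A -> B `<=` A ->
    A `<=` G \/ (2 ^+ m)%:E * mu B <= mu A].
Proof.
move=> bB bG0 BG0; have [G [bG G0G HG]] := doubling_chain m bG0.
exists (hull BB G); split; first exact: hull_balls.
  by apply: subset_trans G0G _; exact: sub_hull_self.
move=> A bA BA; case: HG => [->|HG]; first by left.
have [le2|lt2] := leP (mu A) (2%:E * mu G).
  left; apply: sub_hull => //; have [x Bx] := ball_nonempty bB.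
  by exists x; split; [exact: BA|exact/G0G/BG0].
right; apply: (@le_trans _ _ ((2 ^+ m)%:E * mu G0)).
  rewrite lee_wpmul2l ?lee_fin ?exprn_ge0//; apply: le_measure; rewrite ?inE//.
  - exact: balls_measurable bB.
  - exact: balls_measurable bG0.
apply: (le_trans HG); apply: le_trans (ltW lt2).
by have := ball_fine_gt0 bG; rewrite (ball_fine bG) -EFinM lee_fin; lra.
Qed.

End exhaustion.

Section weighted_growth.
Context {R : realType} {d : measure_display} {X : measurableType d}
        {mu : {measure set X -> \bar R}}.
Variables (BB : ball_basis mu) (r eta : R).
Hypotheses (r1 : (1 <= r)%R) (eta2 : (2 < eta)%R) (dbl : doubling_at BB eta).
Local Notation K := (hull_const BB).
Local Notation Lr_le := (Lr_le (mu := mu) r).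
Variables (f : X -> R) (s : R) (c : set X -> R).
Hypotheses (mf : measurable_fun setT f) (s0 : (0 <= s)%R).
Hypothesis cP : forall B, balls BB B -> Lr_le (fun x => f x - c B)%R B s.
Implicit Types (A B G : set X).

Lemma avg_Lr_le g A (t : R) : balls BB A -> measurable_fun setT g -> (0 <= t)%R ->
  Lr_le g A t -> avg (mu := mu) r (EFin \o g) A <= t%:E.
Proof.
move=> bA mg t0 H; apply: avg_le => //.
- by rewrite (ball_fine bA).
- exact: balls_measure_gt0 bA.
- rewrite /int_pow asboolT; last exact/measurable_EFinP.
  exact: H.
- by apply: int_pow_ge0; rewrite (le_trans _ r1).
Qed.

Definition growth_const : R := (4 * (K * eta + 8 * (K + eta + 1)))%R.

(** The weight [omega_log] exactly compensates the logarithmic growth of the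
    oscillation of [f]; the truncation [c B * \1_G] is felt only by balls which are
    not inside [G], and these are so large that the weight makes it negligible. *)
Lemma omega_growth B G m : balls BB B -> balls BB G ->
  (forall A, balls BB A -> B `<=` A -> A `<=` G \/ (2 ^+ m)%:E * mu B <= mu A) ->
  (`|c B| <= m%:R * s)%R ->
  ereal_sup [set (omega_log (fine (mu A) / fine (mu B)))%:E *
                 avg (mu := mu) r (EFin \o (fun x => f x - c B * \1_G x)%R) A
    | A in [set A | balls BB A /\ B `<=` A]] <= (4 * (growth_const + 1) * s)%:E.
Proof.
move=> bB bG HG cm; have e2 := eta2; have s0' := s0; apply: ge_ereal_sup => _ [A [bA BA] <-].
have K1 := hull_const_ge1 bB.
have b0 := ball_fine_gt0 bB; have a0 := ball_fine_gt0 bA.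
have mA := balls_measurable bA.
set t := (fine (mu A) / fine (mu B))%R.
have t1 : (1 <= t)%R.
  rewrite /t ler_pdivlMr// mul1r -lee_fin -(ball_fine bA) -(ball_fine bB).
  by apply: le_measure; rewrite ?inE//; exact: balls_measurable bB.
have l1 := log2_1D_ge1 t1; have om := omega_log2 t1.
have om0 : (0 <= omega_log t)%R.
  by rewrite /omega_log -/(log2 (1 + t)) invr_ge0; lra.
have C0 : (0 <= growth_const)%R.
  by rewrite /growth_const mulr_ge0// addr_ge0 ?mulr_ge0//; lra.
have Cs0 : (0 <= growth_const * s)%R by rewrite mulr_ge0.
have Csl0 : (0 <= growth_const * s * log2 (1 + t))%R by rewrite mulr_ge0//; lra.
have := growth_log r1 eta2 dbl mf s0 cP bA bB BA; rewrite -/growth_const -/t => HA.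
have mg : measurable_fun setT (fun x => f x - c B * \1_G x)%R.
  apply: measurable_funB => //; apply: measurable_funM; first exact: measurable_cst.
  by apply: measurable_indic; exact: balls_measurable bG.
have mfc : measurable_fun setT (fun x => f x - c B)%R by exact: measurable_funB.
have om_l : (omega_log t * (growth_const * s * log2 (1 + t)) = growth_const * s)%R.
  by rewrite mulrCA om mulr1.
have [AG|large] := HG A bA BA.
  apply: (@le_trans _ _ ((omega_log t)%:E * (growth_const * s * log2 (1 + t))%:E)).
    rewrite lee_wpmul2l// ?lee_fin//; apply: avg_Lr_le => //.
    rewrite /Lr_le; under eq_integral => x xA.
      by rewrite indicE mem_set ?mulr1; [over|apply: AG; exact: set_mem].
    exact: HA.
  by rewrite -EFinM om_l lee_fin; lra.
have om_c : (omega_log t * `|c B| <= s)%R.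
  have lm : (m%:R <= log2 (1 + t))%R.
    have ln2 : (0 < ln 2 :> R)%R by rewrite ln_gt0// ltr1n.
    rewrite /log2 ler_pdivlMr// mulr_natl -lnXn// ler_ln ?posrE ?exprn_gt0//; last by lra.
    have : (2 ^+ m <= t)%R.
      rewrite /t ler_pdivlMr// -lee_fin EFinM -(ball_fine bA) -(ball_fine bB).
      exact: large.
    lra.
  apply: (@le_trans _ _ (omega_log t * (log2 (1 + t) * s))%R).
    by rewrite ler_wpM2l// (le_trans cm)// ler_wpM2r.
  by rewrite mulrA om mul1r.
apply: (@le_trans _ _ ((omega_log t)%:E *
    (4 * (growth_const * s * log2 (1 + t) + `|c B|))%:E)).
  rewrite lee_wpmul2l// ?lee_fin//; apply: avg_Lr_le => //.
    by rewrite mulr_ge0// addr_ge0.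
  apply: (Lr_le_add r1 mA mfc (measurable_cst (c B)) Csl0 (normr_ge0 _) HA).
    exact: Lr_le_cst.
  move=> x _ /=; have -> : (f x - c B * \1_G x = (f x - c B) + c B * (1 - \1_G x))%R by ring.
  apply: (le_trans (ler_normD _ _)); rewrite lerD2l normrM ler_piMr//.
  by rewrite indicE; case: (_ \in _); rewrite /= ?subrr ?subr0 ?normr0 ?normr1.
rewrite -EFinM lee_fin.
have -> : (omega_log t * (4 * (growth_const * s * log2 (1 + t) + `|c B|)) =
  4 * (omega_log t * (growth_const * s * log2 (1 + t)) + omega_log t * `|c B|))%R by ring.
by rewrite om_l; lra.
Qed.

End weighted_growth.

(** * Oscillation of the extremal operator on a ball *)

Section local_estimate.
Context {R : realType} {d : measure_display} {X : measurableType d}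
        {mu : {measure set X -> \bar R}}.
Variables (BB : ball_basis mu) (r eta : R).
Hypotheses (r1 : (1 <= r)%R) (eta2 : (2 < eta)%R) (dbl : doubling_at BB eta).
Local Notation K := (hull_const BB).
Local Notation Lr_le := (Lr_le (mu := mu) r).
Local Notation operator := (@operator R d X).
Variables (I : Type) (T_ : I -> operator) (Phi : (I -> \bar R) -> \bar R).
Hypothesis HPhi : extremal Phi.
Let T : operator := fun f x => Phi (fun i => T_ i f x).
Variables (M L : R).
Hypotheses (M0 : (0 < M)%R) (L0 : (0 < L)%R).
Hypothesis TM : opnorm (mu := mu) r T <= M%:E.
Hypothesis HL0 : forall i, Lr_L0 (mu := mu) r (T_ i).
Hypothesis HCN : common_null_sets BB T_ r.
Hypothesis HBO : forall i, BO_bound BB r omega_log (T_ i) L.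
Hypothesis HUV : uniformly_vanishing BB T_.
Variables (f : X -> R) (s : R) (c : set X -> R).
Hypotheses (fL : f \in Lfun mu r%:E) (s0 : (0 < s)%R).
Hypothesis cP : forall B, balls BB B -> Lr_le (fun x => f x - c B)%R B s.
Implicit Types (A B G : set X).

Let r0 : (0 < r)%R. Proof. exact: lt_le_trans r1. Qed.
Let mf : measurable_fun setT f. Proof. exact: Lfun_measurable fL. Qed.

Definition near_const : R := (4 * (4 * K + 5))%R.

Lemma near_const_ge0 : (0 <= near_const)%R.
Proof. by have := hull_const_gt0 BB; rewrite /near_const; lra. Qed.

Lemma Lr_le_hull B : balls BB B ->
  Lr_le (fun x => f x - c B)%R (hull BB B) (near_const * s)%R.
Proof.
move=> bB; have bhB := hull_balls bB; have K1 := hull_const_ge1 bB.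
have mhB := balls_measurable bhB.
have cc := center_nested r1 mf (ltW s0) cP bB bhB (sub_hull_self bB) K1 (hull_measure bB).
have mfc : measurable_fun setT (fun x => f x - c (hull BB B))%R by exact: measurable_funB.
have := Lr_le_add r1 mhB mfc
  (measurable_cst (c B - c (hull BB B))%R) (ltW s0) (normr_ge0 _) (cP bhB)
  (Lr_le_cst (mu := mu) r (c B - c (hull BB B))%R mhB).
move=> /(_ (fun x => f x - c B)%R) H; apply: (Lr_le_mono r1) (H _).
  rewrite mulr_ge0 ?addr_ge0 ?(ltW s0)//=.
  have -> : (near_const * s = 4 * (s + 4 * (K + 1) * s))%R.
    by rewrite /near_const; ring.
  by rewrite ler_wpM2l// lerD2l.
by move=> x _ /=; rewrite (distrC (c B)) ler_distD.
Qed.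

Definition near_part B x := (- c B * \1_(hull BB B) x + f x * \1_(hull BB B) x)%R.

Lemma near_part_Lfun B : balls BB B -> near_part B \in Lfun mu r%:E.
Proof.
move=> bB; have bhB := hull_balls bB; have mhB := balls_measurable bhB.
apply: Lfun_lin => //; last exact: Lfun_restrict.
exact: Lfun_indic (balls_measure_lty bhB).
Qed.

Lemma near_part_norm B : balls BB B -> 'N[mu]_r%:E[EFin \o near_part B] <=
  (near_const * s * (K * fine (mu B)) `^ r^-1)%:E.
Proof.
move=> bB; have bhB := hull_balls bB; have mhB := balls_measurable bhB.
have b0 := ball_fine_gt0 bB; have K0 := hull_const_gt0 BB.
have ns0 : (0 <= near_const * s)%R by rewrite mulr_ge0 ?near_const_ge0 ?ltW.
have -> : (near_const * s * (K * fine (mu B)) `^ r^-1 =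
   ((near_const * s) `^ r * (K * fine (mu B))) `^ r^-1)%R.
  rewrite [in RHS]powRM ?powR_ge0 ?mulr_ge0 ?(ltW b0) ?(ltW K0)//.
  by rewrite -powRrM divff ?powRr1// gt_eqF.
rewrite Lnorm_EFinE -poweR_EFin; apply: gt0_ler_poweR.
- by rewrite invr_ge0 ltW.
- by rewrite in_itv/= leey andbT; apply: integral_ge0 => x _; rewrite lee_fin powR_ge0.
- by rewrite in_itv/= leey andbT lee_fin !mulr_ge0 ?powR_ge0 ?(ltW b0) ?(ltW K0).
apply: (@le_trans _ _ (\int[mu]_(x in hull BB B) (`|f x - c B| `^ r)%:E)).
  rewrite [leRHS]integral_mkcond; apply: ge0_le_integral_any => x _.
    by rewrite lee_fin powR_ge0.
  rewrite patchE /near_part indicE; case: (_ \in _) => /=.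
    by rewrite !mulr1 addrC.
  by rewrite !mulr0 addr0 normr0 powR0// gt_eqF.
apply: (le_trans (Lr_le_hull bB)); rewrite EFinM lee_wpmul2l ?lee_fin ?powR_ge0//.
by rewrite EFinM -(ball_fine bB); exact: hull_measure.
Qed.

Lemma near_part_tail (kap : R) B : (0 < kap <= 1)%R -> balls BB B ->
  exists W, [/\ measurable W, mu W <= (kap / 2)%:E * mu B & forall x, B x -> ~ W x ->
    forall i, `|T_ i (near_part B) x| <= (M * near_const * (8 * K / kap) * s)%:E].
Proof.
move=> /andP[k0 k1] bB.
have b0 := ball_fine_gt0 bB; have K1 := hull_const_ge1 bB.
have K0 := hull_const_gt0 BB; have s0' := s0; have M0' := M0.
have n0 : (0 < near_const)%R by rewrite /near_const; lra.
set b := fine (mu B) in b0 *.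
pose V := (near_const * s * (K * b) `^ r^-1)%R.
have V0 : (0 < V)%R := mulr_gt0 (mulr_gt0 n0 s0) (powR_gt0 _ (mulr_gt0 K0 b0)).
(* The level at which the weak type bound leaves less than [kap / 4] of [B]. *)
pose t := (M * near_const * (8 * K / kap) * s)%R.
have K8 : (0 < 8 * K)%R by rewrite mulr_gt0.
have t0 : (0 < t)%R := mulr_gt0 (mulr_gt0 (mulr_gt0 M0 n0) (divr_gt0 K8 k0)) s0.
have tail_small : ((M * V / t) `^ r < kap / 4 * b)%R.
  have -> : (M * V / t = kap / (8 * K) * (K * b) `^ r^-1)%R.
    rewrite /V /t; field.
    by rewrite !gt_eqF.
  rewrite powRM ?powR_ge0 ?divr_ge0 ?mulr_ge0 ?(ltW k0) ?(ltW K0)//.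
  rewrite -powRrM mulVf ?gt_eqF// powRr1 ?mulr_ge0 ?(ltW K0) ?(ltW b0)//.
  apply: (@le_lt_trans _ _ (kap / (8 * K) * (K * b))%R).
    rewrite ler_wpM2r ?mulr_ge0 ?(ltW K0) ?(ltW b0)// ge1r_powR//.
    rewrite divr_gt0 ?mulr_gt0//= ler_pdivrMr ?mulr_gt0//; lra.
  have -> : (kap / (8 * K) * (K * b) = kap / 8 * b)%R by field; rewrite gt_eqF.
  by rewrite ltr_pM2r//; lra.
have [W [mW Wa HW]] := family_tail r1 HPhi M0 TM HL0 HCN (near_part_Lfun bB) V0 t0
  (near_part_norm bB) tail_small bB.
exists W; split=> //; apply: (le_trans Wa).
by rewrite (ball_fine bB) -EFinM lee_fin -/b; lra.
Qed.

(** A level high enough in the weak type bound leaves at most a quarter of [B]; off it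
    the values of the family at [f], and so their extremal value, are bounded. *)
Lemma finite_part B : balls BB B ->
  exists W, [/\ measurable W, mu W <= (4^-1)%:E * mu B & forall x, B x -> ~ W x ->
    T f x \is a fin_num].
Proof.
move=> bB; have b0 := ball_fine_gt0 bB; have M0' := M0.
pose V := (fine ('N[mu]_r%:E[EFin \o f]) + 1)%R.
have Nfin : 'N[mu]_r%:E[EFin \o f] \is a fin_num.
  by rewrite ge0_fin_numE ?Lnorm_ge0//; move: fL => /andP[_]; rewrite inE.
have V0 : (0 < V)%R by rewrite ltr_wpDl// fine_ge0// Lnorm_ge0.
have NV : 'N[mu]_r%:E[EFin \o f] <= V%:E.
  by rewrite -[leLHS](fineK Nfin) lee_fin lerDl.
(* [a <= 1] makes [a `^ r <= a]. *)
pose a := Num.min 1%R (fine (mu B) / 16)%R.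
have a0 : (0 < a)%R by rewrite lt_min ltr01 divr_gt0.
have t0 : (0 < M * V / a)%R by rewrite divr_gt0// mulr_gt0.
have tail_small : ((M * V / (M * V / a)) `^ r < fine (mu B) / 8)%R.
  have -> : (M * V / (M * V / a) = a)%R.
    by rewrite invfM invrK mulrA divff ?mul1r// gt_eqF// mulr_gt0.
  apply: (@le_lt_trans _ _ a); first by rewrite ge1r_powR// a0 ge_min lexx.
  by apply: (@le_lt_trans _ _ (fine (mu B) / 16)%R);
     [rewrite ge_min lexx orbT|lra].
have [W [mW Wa HW]] := family_tail r1 HPhi M0 TM HL0 HCN fL V0 t0 NV tail_small bB.
exists W; split=> //.
  by apply: (le_trans Wa); rewrite (ball_fine bB) -EFinM lee_fin; lra.
move=> x Bx nWx; have [i0] := family_inhabited r1 HPhi M0 TM bB.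
have H := extremal_bounded i0 HPhi (HW x Bx nWx).
by rewrite fin_num_abs (le_lt_trans H)// ltry.
Qed.


Definition far_part B G x := ((- c B * \1_G x + f x) * \1_(~` hull BB B) x)%R.

Lemma far_part_Lfun B G : balls BB B -> balls BB G -> far_part B G \in Lfun mu r%:E.
Proof.
move=> bB bG; apply: Lfun_restrict => //.
  by apply: measurableC; exact: balls_measurable (hull_balls bB).
apply: Lfun_lin => //.
exact: Lfun_indic (balls_measurable bG) (balls_measure_lty bG).
Qed.

Lemma near_far_decomposition B G : hull BB B `<=` G ->
  f = (fun y => c B * \1_G y + (1 * near_part B y + far_part B G y))%R.
Proof.
move=> hG; apply/funext => x; rewrite /near_part /far_part !indicE in_setC.
have [/set_mem hx|_] := boolP (x \in hull BB B).
  by rewrite (mem_set (hG x hx)) /= !mulr1 mulr0 addr0 mul1r addrA subrr add0r.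
by rewrite /= !mulr0 addr0 mulr0 add0r mulr1 mulNr addrA subrr add0r.
Qed.

Lemma far_part_osc B G m i : balls BB B -> balls BB G ->
  (forall A, balls BB A -> B `<=` A -> A `<=` G \/ (2 ^+ m)%:E * mu B <= mu A) ->
  (`|c B| <= m%:R * s)%R ->
  osc (mu := mu) B (T_ i (far_part B G)) <=
    (L * (4 * (growth_const BB eta + 1) * s))%:E.
Proof.
move=> bB bG HG cm.
have gL : (fun x => - c B * \1_G x + f x)%R \in Lfun mu r%:E.
  apply: Lfun_lin => //.
  exact: Lfun_indic (balls_measurable bG) (balls_measure_lty bG).
have := HBO i gL bB => /le_trans; apply.
rewrite EFinM lee_wpmul2l ?lee_fin ?(ltW L0)//.
have := omega_growth r1 eta2 dbl mf (ltW s0) cP bB bG HG cm.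
have -> : (fun x => f x - c B * \1_G x)%R = (fun x => - c B * \1_G x + f x)%R.
  by apply/funext => x; rewrite mulNr addrC.
exact.
Qed.

Definition osc_const (kap : R) : R :=
  (1 + 2 * (M * near_const * (8 * K / kap)) + L * (4 * (growth_const BB eta + 1)))%R.

(** With [G] exhausting, [f] splits into the multiple [c B * \1_G], on which the family
    nearly vanishes, a part supported in the hull, controlled by the weak type
    bound, and a part off the hull, controlled by the oscillation bound. *)
Lemma local_estimate (kap : R) B : (0 < kap <= 1)%R -> balls BB B ->
  exists (a : R) (W : set X), [/\ measurable W, mu W <= kap%:E * mu B &
    forall x, B x -> ~ W x -> `|T f x - a%:E| <= (osc_const kap * s)%:E].
Proof.
move=> k01 bB; have /andP[k0 k1] := k01.
have b0 := ball_fine_gt0 bB.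
have bhB := hull_balls bB.
have [Hfin Hlin Hosc] := HCN.
have [W1 [mW1 W1k HW1]] := near_part_tail k01 bB.
have [W2 [mW2 W2k HW2]] := finite_part bB.
pose e := (s / (`|c B| + 1))%R.
have c1 : (0 < `|c B| + 1)%R by rewrite ltr_wpDl.
have e0 : (0 < e)%R by rewrite divr_gt0.
have ce : (`|c B| * e <= s)%R.
  by rewrite /e mulrCA ler_piMr ?(ltW s0)// ler_pdivrMr// mul1r lerDl.
have [B' [bB' BB' HB']] := HUV bB e0.
have [|G0 [bG0 B'G0 hG0]] := common_ball bB' bhB.
  by have [x Bx] := ball_nonempty bB; exists x; split; [exact: BB'|exact: sub_hull_self].
have [m cm] : exists m : nat, (`|c B| <= m%:R * s)%R.
  exists (Num.trunc (`|c B| / s)).+1.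
  by rewrite -ler_pdivrMr// ltW// truncnS_gt.
have [G [bG G0G HG]] := exhausting_ball dbl m bB bG0 (subset_trans BB' B'G0).
have hG : hull BB B `<=` G by exact: subset_trans hG0 G0G.
have GL : \1_G \in Lfun mu r%:E.
  exact: Lfun_indic (balls_measurable bG) (balls_measure_lty bG).
have nL := near_part_Lfun bB.
have uL := far_part_Lfun bB bG.
have nuL := Lfun_lin r1 1%R nL uL.
have [N1 negN1 HN1] := Hosc _ B GL bB.
have [N2 negN2 HN2] := Hosc _ B uL bB.
have fE := near_far_decomposition hG.
have lin : \forall x \ae mu, forall i, exists p a v : R,
    [/\ T_ i \1_G x = p%:E, T_ i (near_part B) x = a%:E,
        T_ i (far_part B G) x = v%:E & T_ i f x = (c B * p + (a + v))%:E].
  have l1 := Hlin (c B) _ _ GL nuL; have l2 := Hlin 1%R _ _ nL uL.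
  have f1 := Hfin _ GL; have f2 := Hfin _ nL; have f3 := Hfin _ uL.
  have ae_and (P Q : X -> Prop) : (\forall x \ae mu, P x) -> (\forall x \ae mu, Q x) ->
      \forall x \ae mu, P x /\ Q x by apply: filterS2.
  have Hlf := ae_and _ _ l1 l2; have Hf := ae_and _ _ f1 f2.
  move: Hlf Hf f3; apply: filterS3 => x [{}l1 {}l2] [{}f1 {}f2] {}f3 i.
  exists (fine (T_ i \1_G x)), (fine (T_ i (near_part B) x)), (fine (T_ i (far_part B G) x)).
  split; rewrite ?fineK//; rewrite fE l1 l2 mul1e.
  by rewrite EFinD EFinM EFinD !fineK.
have [N3 [mN3 N30 HN3]] := lin.
have negN3 : mu.-negligible N3 by apply/negligibleP.
have [N [mN N0 NN]] := negligibleU (negligibleU negN1 negN2) negN3.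
have mW : measurable (W1 `|` W2) by exact: measurableU.
have muW : mu (W1 `|` W2) <= ((kap / 2 + 4^-1) * fine (mu B))%:E.
  apply: (le_trans (measureU2 _ mW1 mW2)).
  by rewrite mulrDl EFinD !EFinM -(ball_fine bB); exact: leeD.
(* The constant is the value of [T f] at a good point [x0]: the extremal
   functionals are 1-Lipschitz in the values of the family. *)
have [x0 [Bx0 nWx0 nNx0]] : exists x, [/\ B x, ~ (W1 `|` W2) x & ~ N x].
  apply: (ball_escape bB mW); last by exists N; split.
  apply: (le_lt_trans muW); rewrite (ball_fine bB) lte_fin gtr_pMl//; lra.
have good x : ~ N x -> [/\ ~ N1 x, ~ N2 x & forall i, exists p a v : R,
    [/\ T_ i \1_G x = p%:E, T_ i (near_part B) x = a%:E,
        T_ i (far_part B G) x = v%:E & T_ i f x = (c B * p + (a + v))%:E]].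
  move=> nNx; have /not_orP[/not_orP[nN1 nN2] nN3] :
    ~ ((N1 `|` N2) `|` N3) x by move=> /NN.
  by split=> //; apply: contrapT => nH; apply: nN3; exact: HN3.
have [nN1x0 nN2x0 T0] := good _ nNx0.
move/not_orP : nWx0 => [nW1x0 nW2x0].
have Tfx0 : T f x0 \is a fin_num := HW2 _ Bx0 nW2x0.
exists (fine (T f x0)), (W1 `|` N); split; first exact: measurableU.
  apply: (le_trans (measureU2 _ mW1 mN)).
  rewrite [X in _ + X](_ : _ = 0) ?adde0; last exact: N0.
  apply: (le_trans W1k); rewrite lee_wpmul2r// lee_fin; lra.
move=> x Bx /not_orP[nW1x nNx]; rewrite fineK//.
have [nN1x nN2x Tx] := good _ nNx.
apply: extremal_close => //.
- by move=> i; have [p [a [v [_ _ _ ->]]]] := Tx i.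
- by move=> i; have [p [a [v [_ _ _ ->]]]] := T0 i.
move=> i; have [p [a [v [Ep Ea Ev ->]]]] := Tx i.
have [p' [a' [v' [Ep' Ea' Ev' ->]]]] := T0 i.
have := HW1 x Bx nW1x i; rewrite Ea lee_fin => Ha.
have := HW1 x0 Bx0 nW1x0 i; rewrite Ea' lee_fin => Ha'.
have := le_trans (HN1 i x x0 (conj Bx nN1x) (conj Bx0 nN1x0)) (HB' G i bG _).
rewrite Ep Ep' => /(_ (subset_trans B'G0 G0G)); rewrite lee_fin => Hp.
have := le_trans (HN2 i x x0 (conj Bx nN2x) (conj Bx0 nN2x0)) (far_part_osc i bB bG HG cm).
rewrite Ev Ev' lee_fin => Hv.
rewrite lee_fin.
have -> : (c B * p + (a + v) - (c B * p' + (a' + v')) =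
  c B * (p - p') + (a - a') + (v - v'))%R by ring.
have -> : (osc_const kap * s = s + (M * near_const * (8 * K / kap) * s +
  M * near_const * (8 * K / kap) * s) + L * (4 * (growth_const BB eta + 1) * s))%R.
  by rewrite /osc_const; ring.
apply: (le_trans (ler_normD _ _)); apply: lerD => //.
apply: (le_trans (ler_normD _ _)); apply: lerD; last first.
  by apply: (le_trans (ler_normB _ _)); apply: lerD.
by rewrite normrM (le_trans _ ce)// ler_wpM2l.
Qed.

End local_estimate.

(** * The bound for the BMO norm *)

Section bmo_bound.
Context {R : realType} {d : measure_display} {X : measurableType d}
        {mu : {measure set X -> \bar R}}.
Variables (BB : ball_basis mu) (r eta : R).
Hypotheses (r1 : (1 <= r)%R) (eta2 : (2 < eta)%R) (dbl : doubling_at BB eta).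
Local Notation K := (hull_const BB).

(** The exceptional sets must be so small that the mass of the balls of
    [jn_step] decays faster than the [r]-th powers of the levels grow. *)
Definition small_const : R := (2 `^ (- (r + 1)) / (4 * K * eta) / K)%R.

Definition bmo_const (M L : R) : R :=
  (12 * r * osc_const BB eta M L small_const)%R.

Lemma osc_const_gt0 B (M L kap : R) : balls BB B -> (0 < M)%R -> (0 < L)%R ->
  (0 < kap)%R -> (0 < osc_const BB eta M L kap)%R.
Proof.
move=> bB M0 L0 k0; have K1 := hull_const_ge1 bB; have e2 := eta2.
have K0 := hull_const_gt0 BB.
have g0 : (0 <= growth_const BB eta)%R.
  by rewrite /growth_const mulr_ge0// addr_ge0 ?mulr_ge0//; lra.
have p1 : (0 <= M * near_const BB * (8 * K / kap))%R.
  rewrite mulr_ge0 ?divr_ge0 ?(ltW k0)//; last by lra.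
  exact: mulr_ge0 (ltW M0) (near_const_ge0 BB).
have p2 : (0 <= L * (4 * (growth_const BB eta + 1)))%R.
  by apply: mulr_ge0 (ltW L0) _; lra.
by rewrite /osc_const; lra.
Qed.

Lemma small_constP B : balls BB B ->
  (0 < small_const <= 1)%R /\ (4 * K * eta * (small_const * K) = 2 `^ (- (r + 1)))%R.
Proof.
move=> bB; have K1 := hull_const_ge1 bB; have e2 := eta2; have r1' := r1.
have K0 := hull_const_gt0 BB.
have Ke0 : (0 < 4 * K * eta)%R by rewrite !mulr_gt0//; lra.
have q0 : (0 < 2 `^ (- (r + 1)) :> R)%R by exact: powR_gt0.
split; last first.
  by rewrite /small_const divfK ?gt_eqF// mulrC divfK// gt_eqF.
rewrite /small_const !divr_gt0//= ler_pdivrMr// mul1r ler_pdivrMr//.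
apply: (@le_trans _ _ 1%R).
  by rewrite -[leRHS](powRr0 (2 : R)) ler_powR ?ler1n//; lra.
rewrite (le_trans K1)// ler_peMr ?(ltW K0)// -mulrA mulrCA.
rewrite (le_trans K1)// ler_peMr ?(ltW K0)//; lra.
Qed.

Variables (I : Type) (T_ : I -> @operator R d X) (Phi : (I -> \bar R) -> \bar R).
Hypothesis HPhi : extremal Phi.
Let T : @operator R d X := fun f x => Phi (fun i => T_ i f x).

Lemma bmo_norm_extremal (M L s : R) f : (0 < M)%R -> (0 < L)%R ->
  opnorm (mu := mu) r T <= M%:E -> (forall i, Lr_L0 (mu := mu) r (T_ i)) ->
  common_null_sets BB T_ r -> (forall i, BO_bound BB r omega_log (T_ i) L) ->
  uniformly_vanishing BB T_ -> f \in Lfun mu r%:E -> (0 < s)%R ->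
  bmo_norm BB r (EFin \o f) < s%:E ->
  bmo_norm BB r (T f) <= (bmo_const M L * s)%:E.
Proof.
move=> M0 L0 TM HL0 HCN HBO HUV fL s0 fs.
have r0 : (0 < r)%R by exact: lt_le_trans r1.
have /choice[c cP] B : exists c, balls BB B -> Lr_le (mu := mu) r (fun x => f x - c)%R B s.
  have [bB|nB] := pselect (balls BB B); last by exists 0%R.
  by have [c Hc] := bmo_center r1 (Lfun_measurable fL) bB fs; exists c.
set lam := (osc_const BB eta M L small_const * s)%R.
have /choice[a aP] B : exists a, balls BB B -> exists W : set X, [/\ measurable W,
    mu W <= (small_const * K)%:E * mu B &
    forall x, hull BB B x -> ~ W x -> `|T f x - a%:E| <= lam%:E].
  have [bB|nB] := pselect (balls BB B); last by exists 0%R.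
  have [k01 _] := small_constP bB; have /andP[k0 _] := k01.
  have [a [W [mW Wk HW]]] := local_estimate r1 eta2 dbl HPhi M0 L0 TM HL0 HCN HBO HUV
    fL s0 cP k01 (hull_balls bB).
  exists a => _; exists W; split=> //; apply: (le_trans Wk).
  rewrite (EFinM small_const K) -muleA lee_wpmul2l ?lee_fin ?(ltW k0)//; exact: hull_measure.
have /choice[W WP] B : exists W : set X, balls BB B -> [/\ measurable W,
    mu W <= (small_const * K)%:E * mu B &
    forall x, hull BB B x -> ~ W x -> `|T f x - (a B)%:E| <= lam%:E].
  have [bB|nB] := pselect (balls BB B); last by exists set0.
  by have [W HW] := aP B bB; exists W.
apply: ge_ereal_sup => _ [B bB <-].
have [/andP[k0 k1] kq] := small_constP bB.
have lam0 : (0 < lam)%R by rewrite mulr_gt0// (osc_const_gt0 bB).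
have HT : tails (mu := mu) (2 `^ (- (r + 1))) (T f) B (a B) (lam + lam)%R.
  move=> n; apply: (jn_iter eta2 dbl _ _ _ (ltW lam0) WP) => //.
  - by rewrite mulr_gt0// hull_const_gt0.
  - by rewrite kq.
  - by rewrite -[leRHS](powRr0 (2 : R)) ler_powR ?ler1n//; have := r1; lra.
have := sharp_avg_tails r1 _ (balls_measurable bB) _ (balls_measure_gt0 bB) HT.
rewrite addr_gt0// (ball_fine bB) => /(_ isT isT) /le_trans; apply.
rewrite lee_fin /bmo_const le_eqVlt; apply/orP; left; apply/eqP.
by rewrite /lam; ring.
Qed.

Lemma bmo_norm_ge0 f B : balls BB B -> 0 <= bmo_norm BB r (EFin \o f).
Proof.
move=> bB; apply: (@le_trans _ _ (sharp_avg (mu := mu) r (EFin \o f) B)); last first.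
  by apply: ereal_sup_ubound; exists B.
rewrite /sharp_avg; case: asboolP => _; first exact: poweR_ge0.
by apply: le_ereal_inf_tmp => _ [c _ <-]; exact: poweR_ge0.
Qed.

Lemma BO_bound_le S (L1 L2 : R) : (L1 <= L2)%R ->
  BO_bound BB r omega_log S L1 -> BO_bound BB r omega_log S L2.
Proof.
move=> L12 H f B fL bB; apply: (le_trans (H f B fL bB)).
rewrite lee_wpmul2r ?lee_fin//.
apply: (@le_trans _ _ ((omega_log (fine (mu B) / fine (mu B)))%:E *
    avg (mu := mu) r (EFin \o f) B)).
  rewrite mule_ge0 ?poweR_ge0// lee_fin divff ?gt_eqF ?(ball_fine_gt0 bB)//.
  by rewrite /omega_log invr_ge0 divr_ge0// ln_ge0//; lra.
by apply: ereal_sup_ubound; exists B => //; split.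
Qed.

End bmo_bound.

Theorem corollary1p1 (R : realType) (d : measure_display)
    (X : measurableType d) (mu : {measure set X -> \bar R})
    (BB : ball_basis mu) (r : R) :
  doubling BB -> regular BB -> (1 <= r)%R ->
  exists C : R -> R -> R,
    forall (I : Type) (T_ : I -> @operator R d X) (T : @operator R d X),
      (forall i, linear_op (mu := mu) r (T_ i)) ->
      (forall i, BO BB r omega_log (T_ i)) ->
      uniformly_vanishing BB T_ ->
      common_null_sets BB T_ r ->
      T = sup_op T_ \/ T = inf_op T_ \/ T = sup_abs_op T_ ->
      opnorm (mu := mu) r T < +oo ->
      ereal_sup [set BO_norm BB r omega_log (T_ i) | i in setT] < +oo ->
      forall f : X -> R, f \in Lfun mu r%:E -> BMO BB r (EFin \o f) ->
        BMO BB r (T f) /\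
        bmo_norm BB r (T f) <=
          (C (fine (opnorm (mu := mu) r T))
             (fine (ereal_sup [set BO_norm BB r omega_log (T_ i)
                              | i in setT])))%:E
          * bmo_norm BB r (EFin \o f).
Proof.
move=> [eta eta2 dbl] _ r1.
exists (fun M L => bmo_const BB r eta (`|M| + 1) (`|L| + 1))%R.
move=> I T_ T _ HBO HUV HCN HT TM LS f fL fB.
have [[B0 bB0]|nB] := pselect (exists B, balls BB B); last first.
  (* Without balls the norms are suprema of the empty set. *)
  have balls0 : balls BB = set0.
    by apply/seteqP; split=> // B bB; apply: nB; exists B.
  have normNy F : bmo_norm BB r F = -oo by rewrite /bmo_norm balls0 image_set0 ereal_sup0.
  by rewrite /BMO !normNy; split; rewrite ?ltNye// leNye.
have [Phi HPhi TE] : exists2 Phi, extremal Phi & T = (fun f x => Phi (fun i => T_ i f x)).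
  case: HT => [->|[->|->]].
  - by exists (fun p => ereal_sup [set p i | i in setT]) => //; constructor 1.
  - by exists (fun p => ereal_inf [set p i | i in setT]) => //; constructor 2.
  - by exists (fun p => ereal_sup [set `|p i| | i in setT]) => //; constructor 3.
set M := opnorm r T in TM *; set S := ereal_sup _ in LS *.
have fine_le (y : \bar R) : y < +oo -> y <= (`|fine y| + 1)%:E.
  case: y => [y| |]// _; rewrite ?leNye// lee_fin /=.
  by rewrite (le_trans (ler_norm y))// lerDl.
have n0 := bmo_norm_ge0 r f bB0.
have nfin : bmo_norm BB r (EFin \o f) \is a fin_num by rewrite ge0_fin_numE.
set n := bmo_norm BB r (EFin \o f) in fB n0 nfin *.
have M0 : (0 < `|fine M| + 1)%R by rewrite ltr_wpDl.
have L0 : (0 < `|fine S| + 1)%R by rewrite ltr_wpDl.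
have BOL i : BO_bound BB r omega_log (T_ i) (`|fine S| + 1)%R.
  have : BO_norm BB r omega_log (T_ i) < (`|fine S| + 1)%:E.
    apply: (@le_lt_trans _ _ S); first by apply: ereal_sup_ubound; exists i.
    case: (S) LS => [y| |]// _; rewrite ?ltNyr// lte_fin /=.
    by rewrite (le_lt_trans (ler_norm y))// ltrDl.
  by move=> /ereal_inf_lt[_ [L HL <-]]; rewrite lte_fin => ltL; exact: BO_bound_le (ltW ltL) HL.
set C := bmo_const BB r eta (`|fine M| + 1)%R (`|fine S| + 1)%R.
have C0 : (0 < C)%R.
  have [/andP[k0 _] _] := small_constP r1 eta2 bB0.
  by rewrite !mulr_gt0 ?(lt_le_trans _ r1)// (osc_const_gt0 eta2 bB0).
have bound s : (0 < s)%R -> n < s%:E -> bmo_norm BB r (T f) <= (C * s)%:E.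
  move=> s0 ns; rewrite TE.
  apply: (bmo_norm_extremal r1 eta2 dbl HPhi M0 L0 _ _ HCN BOL HUV fL s0 ns).
  - by rewrite -TE; exact: fine_le.
  - by move=> i; have [] := HBO i.
(* The estimates above need a strict bound [s] of the norm of [f]; let [s] tend to it. *)
have le_Cn : bmo_norm BB r (T f) <= C%:E * n.
  apply/lee_addgt0Pr => e e0; have eC : (0 < e / C)%R by rewrite divr_gt0.
  have f0 : (0 <= fine n)%R by exact: fine_ge0.
  have -> : C%:E * n + e%:E = (C * (fine n + e / C))%:E.
    by rewrite mulrDr mulrCA divff ?gt_eqF// mulr1 EFinD (EFinM C (fine n)) fineK.
  by apply: bound; [rewrite ltr_wpDl|rewrite -[ltLHS](fineK nfin) lte_fin ltrDl].
split; last exact: le_Cn.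
rewrite /BMO; apply: (le_lt_trans le_Cn).
by rewrite -(fineK nfin) -(EFinM C) ltry.
Qed.
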